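(* Consider the $\mathcal{S}$-$\mathcal{AB}$ iteration described in the context, and suppose that Assumptions 1 (objective function) and 2 (weight matrices and networks), as written out in the context, hold. Let $L:=\max_{1\le i\le n}\sqrt{\mathbb{E}[L_i^2(\zeta_i)]}$. (1) Let the step-size be $\alpha_k=a/(k+b)^{\alpha}$ with $\alpha\in(1/2,1)$ and positive scalars $a,b$ satisfying $\frac{a}{b^{\alpha}}\le\min\{1,\frac{n}{u^\intercal v L}\}$. Then $$\mathbb{E}\left[\|\bar x_k-x^*\|^2\right]=\mathcal{O}(\alpha_k).$$ (2) If instead $\alpha_k=a/(k+b)$ with positive scalars $a,b$ satisfying $\frac{n^2}{u^\intercal v\,\mu}<a\le\min\{1,\frac{n}{u^\intercal v L}\}\,b$, then $$\mathbb{E}\left[\|\bar x_k-x^*\|^2\right]=\mathcal{O}\left(\frac1k\right).$$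
   Context: Notation. $\|\cdot\|$ is the Euclidean norm, $\otimes$ the Kronecker product, $\mathbf{1}$ the all-ones vector, $\mathbf{I}_d$ the $d\times d$ identity. For positive sequences, $a_k=\mathcal{O}(b_k)$ means there is $c>0$ with $a_k\le c\,b_k$. Problem. Let $\mathcal{V}=\{1,\dots,n\}$ be a set of agents. Agent $j$ has the cost $f_j(x)=\mathbb{E}[g_j(x;\zeta_j)]$, $x\in\mathbb{R}^d$, where $\zeta_j$ is a random variable on a probability space $(\Omega,\mathcal{F},\mathrm{P})$. The problem is to minimize $f(x)=\sum_{j=1}^n f_j(x)$ over $\mathbb{R}^d$; $x^*$ denotes its optimal solution. Gradients $\nabla g_i$ are with respect to $x$. $\mathcal{S}$-$\mathcal{AB}$ iteration. Given weight matrices $\mathbf{A}=(a_{ij}),\mathbf{B}=(b_{ij})\in\mathbb{R}^{n\times n}$, step-sizes $\alpha_k>0$, and initial values $x_{i,0}\in\mathbb{R}^d$, set $y_{i,0}=\nabla g_i(x_{i,0};\zeta_{i,0})$ and, for $k\ge0$ and $i\in\mathcal{V}$, $$x_{i,k+1}=\sum_{j=1}^n a_{ij}x_{j,k}-\alpha_k y_{i,k},$$ $$y_{i,k+1}=\sum_{j=1}^n b_{ij}y_{j,k}+\nabla g_i(x_{i,k+1};\zeta_{i,k+1})-\nabla g_i(x_{i,k};\zeta_{i,k}),$$ where the vectors $(\zeta_{1,k},\dots,\zeta_{n,k})$, $k\ge0$, are i.i.d. copies of $(\zeta_1,\dots,\zeta_n)$. Assumption 1 (objective function). (i) $f$ is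 differentiable and $\mu$-strongly convex ($\mu>0$): $f(y)\ge f(x)+\langle\nabla f(x),y-x\rangle+\frac{\mu}{2}\|x-y\|^2$ for all $x,y\in\mathbb{R}^d$. (ii) There is $c>0$ with $\|\nabla f(x)-\nabla^2 f(x^* )(x-x^* )\|\le c\|x-x^*\|^2$ for all $x\in\mathbb{R}^d$. (iii) For each $i\in\mathcal{V}$, $g_i(\cdot;\zeta_i)$ is differentiable and there are constants $p>2$, $U_1>0$ such that for all $x,y\in\mathbb{R}^d$: $\mathbb{E}[\|\nabla g_i(x;\zeta_i)-\nabla f_i(x)\|^p]\le U_1^{p/2}$ and $\|\nabla g_i(x;\zeta_i)-\nabla g_i(y;\zeta_i)\|\le L_i(\zeta_i)\|x-y\|$, where $L_i(\zeta_i)$ is a positive random variable with $\mathbb{E}[L_i^p(\zeta_i)]<\infty$. Assumption 2 (weight matrices and networks). For a nonnegative matrix $\mathbf{M}\in\mathbb{R}^{n\times n}$, the directed graph induced by $\mathbf{M}$ has node set $\mathcal{V}$ and an edge $(j,i)$ (from $j$ to $i$) iff $\mathbf{M}_{ij}>0$. Let $\mathcal{G}_A$ and $\mathcal{G}_{B^\intercal}$ be the graphs induced by $\mathbf{A}$ and $\mathbf{B}^\intercal$. (i) $\mathbf{A}$ is nonnegative and row stochastic ($\mathbf{A}\mathbf{1}=\mathbf{1}$), $\mathbf{B}$ is nonnegative and column stochastic ($\mathbf{1}^\intercal\mathbf{B}=\mathbf{1}^\intercal$), and $\mathbf{A}_{ii}>0$, $\mathbf{B}_{ii}>0$ for all $i$.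 (ii) $\mathcal{G}_A$ and $\mathcal{G}_{B^\intercal}$ each contain at least one (directed) spanning tree, and at least one node is a root of spanning trees of both, i.e. $\mathcal{R}_A\cap\mathcal{R}_{B^\intercal}\neq\emptyset$, where $\mathcal{R}_A$ (resp. $\mathcal{R}_{B^\intercal}$) is the set of roots of all spanning trees of $\mathcal{G}_A$ (resp. $\mathcal{G}_{B^\intercal}$). Under Assumption 2, $u^\intercal$ denotes the nonnegative left eigenvector of $\mathbf{A}$ for eigenvalue $1$ with $u^\intercal\mathbf{1}=n$, and $v$ the nonnegative right eigenvector of $\mathbf{B}$ for eigenvalue $1$ with $\mathbf{1}^\intercal v=n$; one has $u^\intercal v>0$. Let $x_k\in\mathbb{R}^{nd}$ be the concatenation of $x_{1,k},\dots,x_{n,k}$, and $\bar x_k=\left(\frac{u^\intercal}{n}\otimes\mathbf{I}_d\right)x_k=\frac1n\sum_{i=1}^n u_i x_{i,k}$. *)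

(* Defs.v *)
From HB Require Import structures.
From mathcomp Require Import all_boot all_order all_algebra.
From mathcomp Require Import all_classical all_reals all_analysis.
Set Implicit Arguments. Unset Strict Implicit. Unset Printing Implicit Defensive.
Import Order.TTheory GRing.Theory Num.Theory.
Import numFieldNormedType.Exports.
Local Open Scope classical_set_scope.
Local Open Scope ring_scope.

(* Vectors of R^d are row vectors 'rV[R]_d. *)

Section Euclidean.
Variables (R : realType) (d : nat).
Implicit Types x y : 'rV[R]_d.

Definition dotv x y : R := \sum_(j < d) x 0 j * y 0 j.

(* The library's `|x| on matrices is the sup norm. *)
Definition enorm x : R := Num.sqrt (dotv x x).

Definition grad (f : 'rV[R]_d -> R) x : 'rV[R]_d :=
  \row_(j < d) 'D_(delta_mx 0 j) f x.

(* Entry (j, i) is the j-th partial derivative of the i-th component of the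
   gradient: the Jacobian acts on row vectors by right multiplication. *)
Definition hessian (f : 'rV[R]_d -> R) x : 'M[R]_d := 'J (grad f) x.

Definition strongly_convex (mu : R) (f : 'rV[R]_d -> R) : Prop :=
  forall x y,
    f x + dotv (grad f x) (y - x) + mu / 2 * enorm (x - y) ^+ 2 <= f y.

End Euclidean.

Section Digraphs.
Variable n : nat.

Definition induced_edge (R : realType) (M : 'M[R]_n) : rel 'I_n :=
  fun j i => 0 < M i j.

(* The root r has in-degree 0 in T and every other node in-degree 1. *)
Definition spanning_tree (e : rel 'I_n) (T : {set 'I_n * 'I_n}) (r : 'I_n) :=
  [/\ forall j i, (j, i) \in T -> e j i,
      forall i, #|[set j | (j, i) \in T]| = (i != r) :> nat
    & forall i, connect [rel j k | (j, k) \in T] r i].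

Definition root_set (e : rel 'I_n) : set 'I_n :=
  [set r | exists T, spanning_tree e T r].

End Digraphs.

Record network_assumption (R : realType) (n : nat) (A B : 'M[R]_n) : Prop := {
  net_A_ge0 : forall i j, 0 <= A i j;
  net_A_row_stochastic : A *m const_mx 1 = const_mx 1 :> 'cV[R]_n;
  net_B_ge0 : forall i j, 0 <= B i j;
  net_B_col_stochastic : const_mx 1 *m B = const_mx 1 :> 'rV[R]_n;
  net_A_diag_gt0 : forall i, 0 < A i i;
  net_B_diag_gt0 : forall i, 0 < B i i;
  net_A_tree : exists T r, spanning_tree (induced_edge A) T r;
  net_B_tree : exists T r, spanning_tree (induced_edge B^T) T r;
  net_common_root :
    root_set (induced_edge A) `&` root_set (induced_edge B^T) !=set0 }.

Section Sampling.
Variables (R : realType) (n : nat).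
Variables (dZ : 'I_n -> measure_display) (Z : forall i, measurableType (dZ i)).
Variables (dO : measure_display) (Omega : measurableType dO).
Variable P : probability Omega R.

(* Product sigma-algebra on the space of values of (zeta_1, ..., zeta_n),
   generated by the coordinate projections. *)
Definition prod_measurable : set (set (forall i, Z i)) :=
  <<s [set S | exists i (C : set (Z i)),
         measurable C /\ S = [set z | C (z i)]] >>.

Definition same_law (X Y : Omega -> forall i, Z i) : Prop :=
  forall S, prod_measurable S -> P (X @^-1` S) = P (Y @^-1` S).

Definition mutually_independent (X : nat -> Omega -> forall i, Z i) : Prop :=
  forall (K : seq nat) (S : nat -> set (forall i, Z i)),
    uniq K -> (forall k, prod_measurable (S k)) ->
    P (\bigcap_(k in [set` K]) (X k @^-1` S k)) =
      (\prod_(k <- K) P (X k @^-1` S k))%E.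

(* The components zeta_1, ..., zeta_n at a given time may be dependent. *)
Definition iid_copies (X : Omega -> forall i, Z i)
    (Xs : nat -> Omega -> forall i, Z i) : Prop :=
  mutually_independent Xs /\ forall k, same_law (Xs k) X.

End Sampling.

Section Problem.
Variables (R : realType) (n d : nat).
Variables (dZ : 'I_n -> measure_display) (Z : forall i, measurableType (dZ i)).
Variables (dO : measure_display) (Omega : measurableType dO).
Variable P : probability Omega R.
Variable g : forall i, 'rV[R]_d -> Z i -> R.
Arguments g : clear implicits.

(* The expectations defining the f_j exist. *)
Definition finite_costs (zeta : forall i, {mfun Omega >-> Z i}) : Prop :=
  forall i x, measurable_fun setT (g i x) /\
    P.-integrable setT (fun w => (g i x (zeta i w))%:E).

Definition local_cost (zeta : forall i, {mfun Omega >-> Z i}) (i : 'I_n)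
    (x : 'rV[R]_d) : R :=
  fine ('E_P[fun w => g i x (zeta i w)])%E.

Definition cost (zeta : forall i, {mfun Omega >-> Z i}) (x : 'rV[R]_d) : R :=
  \sum_(i < n) local_cost zeta i x.

Record objective_assumption (zeta : forall i, {mfun Omega >-> Z i})
    (Lip : forall i, {mfun Z i >-> R}) (mu : R) (xstar : 'rV[R]_d) : Prop := {
  obj_mu_gt0 : 0 < mu;
  obj_differentiable : forall x, differentiable (cost zeta) x;
  obj_strongly_convex : strongly_convex mu (cost zeta);
  (* Existence of the Hessian at xstar; it also follows from obj_hessian. *)
  obj_twice_differentiable : differentiable (grad (cost zeta)) xstar;
  obj_hessian : exists2 c : R, 0 < c & forall x,
    enorm (grad (cost zeta) x - (x - xstar) *m hessian (cost zeta) xstar)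
      <= c * enorm (x - xstar) ^+ 2;
  obj_sample_differentiable : forall i z x, differentiable (g i ^~ z) x;
  obj_moments : forall i, exists p U1 : R, [/\ 2 < p, 0 < U1,
    forall x, ('E_P[fun w => (enorm (grad (g i ^~ (zeta i w)) x -
                                     grad (local_cost zeta i) x) `^ p)%R]
                 <= (U1 `^ (p / 2))%:E)%E
    & ('E_P[fun w => (Lip i (zeta i w) `^ p)%R] < +oo)%E];
  obj_lipschitz_gt0 : forall i z, 0 < Lip i z;
  obj_lipschitz : forall i z x y,
    enorm (grad (g i ^~ z) x - grad (g i ^~ z) y) <= Lip i z * enorm (x - y) }.

Definition mean_lipschitz (zeta : forall i, {mfun Omega >-> Z i})
    (Lip : forall i, {mfun Z i >-> R}) : R :=
  \big[Num.max/0]_(i < n)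
    Num.sqrt (fine ('E_P[fun w => (Lip i (zeta i w) ^+ 2)%R])%E).

(* (x_k, y_k) along the sample path z. *)
Fixpoint sab (A B : 'M[R]_n) (alpha : nat -> R) (x0 : 'I_n -> 'rV[R]_d)
    (z : nat -> forall i, Z i) (k : nat) :
    ('I_n -> 'rV[R]_d) * ('I_n -> 'rV[R]_d) :=
  match k with
  | 0%N => (x0, fun i => grad (g i ^~ (z 0%N i)) (x0 i))
  | m.+1 =>
      let: (x, y) := sab A B alpha x0 z m in
      let x' := fun i => (\sum_(j < n) A i j *: x j) - alpha m *: y i in
      (x', fun i => (\sum_(j < n) B i j *: y j) +
                    grad (g i ^~ (z m.+1 i)) (x' i) -
                    grad (g i ^~ (z m i)) (x i))
  end.

Definition xbar (u : 'rV[R]_n) (x : 'I_n -> 'rV[R]_d) : 'rV[R]_d :=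
  n%:R^-1 *: \sum_(i < n) u 0 i *: x i.

Definition mean_square_error (zetas : nat -> forall i, {mfun Omega >-> Z i})
    (A B : 'M[R]_n) (alpha : nat -> R) (x0 : 'I_n -> 'rV[R]_d)
    (u : 'rV[R]_n) (xstar : 'rV[R]_d) (k : nat) : \bar R :=
  ('E_P[fun w => (enorm (xbar u (sab A B alpha x0
           (fun m i => zetas m i w) k).1 - xstar) ^+ 2)%R])%E.

End Problem.

(* Main.v *)
(* Write G_k for the matrix of sampled gradients at time k and T_k = y_k - G_k.
   Then (x_k, T_k) is a function of the samples before time k, so it is a Markov
   chain driven by the i.i.d. samples.  The tracking error does not tend to 0,
   but it telescopes: there is a row vector q with q (B - I) = u - (uv/n) 1, and
     z_k = xbar_k + (alpha_k / n) q T_k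
   satisfies
     z_(k+1) = z_k - alpha_k (uv/n^2) 1 G_k
               + ((alpha_(k+1) - alpha_k) / n) q T_(k+1),
   a stochastic gradient step up to an error of order alpha_k^2.  With quadratic
   forms Q_A, Q_B contracted by A on disagreements and by B on zero-sum matrices
   (some power of the deflated matrices is small since a common root exists), the
   Lyapunov function
     W_k = |z_k - x*|^2 + Q_A(x_k - 1 xbar_k) + c alpha_k^2 Q_B(T_k)
   satisfies E W_(k+1) <= (1 - theta alpha_k) E W_k + C alpha_k^2 for large k,
   for any theta < mu uv/n^2.  Hence E W_k = O(alpha_k) as soon as
   alpha_k - alpha_(k+1) <= tau alpha_k^2 eventually, for some tau < theta. *)
Require Import Defs.
From HB Require Import structures.
From mathcomp Require Import all_boot all_order all_algebra.
From mathcomp Require Import all_classical all_reals all_analysis.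
From mathcomp Require Import measurable_realfun ring lra.
Set Implicit Arguments. Unset Strict Implicit. Unset Printing Implicit Defensive.
Import Order.TTheory GRing.Theory Num.Theory.
Import numFieldNormedType.Exports.
Local Open Scope classical_set_scope.
Local Open Scope ring_scope.

(** * Powers of deflated stochastic matrices *)

(** The obstacle is the noise. Fresh samples enter the tracker at every step without a factor
    alpha_k, so T_k stays of order 1 in mean square; bounding u T_k by its norm would leave a
    perturbation as large as the gradient step itself. The vector q exists because u - (uv/n) 1
    annihilates v, which spans the right kernel of B - I. The correction is then a summation by
    parts: it moves the factor from alpha_k onto the difference alpha_(k+1) - alpha_k. The same
    noise of order 1 is the reason for the weight alpha_k^2 in front of Q_B. The matrices T_k have
    zero column sums, since B is column stochastic and y_0 = G_0; this is what allows B to be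
    replaced by its deflation. The two schedules differ only in tau: for an exponent below 1 every
    tau > 0 is allowed, while the harmonic step has tau = 1/a, and the lower bound on a says exactly
    that 1/a < mu uv/n^2. Since the drift inequality holds only for small steps, finiteness of the
    second moments before that time needs a separate, crude argument. *)

Section MatrixPowers.
Variables (R : realType) (n : nat).
Implicit Types C D S : 'M[R]_n.

Definition mpow C t : 'M[R]_n := iter t (mulmx C) 1%:M.

Lemma mpowS C t : mpow C t.+1 = C *m mpow C t. Proof. by []. Qed.

Lemma mpowSr C t : mpow C t.+1 = mpow C t *m C.
Proof.
elim: t => [|t IH]; first by rewrite mpowS mulmx1 mul1mx.
by rewrite mpowS {1}IH mulmxA -mpowS.
Qed.

Lemma mpow_tr C t : (mpow C t)^T = mpow C^T t.
Proof.
elim: t => [|t IH]; first exact: trmx1.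
by rewrite mpowS trmx_mul IH mpowSr.
Qed.

Lemma mpow_mul C s t : mpow C (s * t) = mpow (mpow C s) t.
Proof.
elim: t => [|t IH]; first by rewrite muln0.
rewrite mulnS mpowS -IH; elim: s {IH} (s * t)%N => [|s IH] r.
  by rewrite mul1mx.
by rewrite addSn mpowS IH mulmxA -mpowS.
Qed.

Lemma mpow_ge0 C t : (forall i j, 0 <= C i j) -> forall i j, 0 <= mpow C t i j.
Proof.
move=> C0; elim: t => [|t IH] i j.
  by rewrite /mpow /= mxE; case: (i == j).
by rewrite mpowS mxE; apply: sumr_ge0 => k _; rewrite mulr_ge0.
Qed.

Lemma mpow_col_stochastic C t : const_mx 1 *m C = const_mx 1 :> 'rV_n ->
  const_mx 1 *m mpow C t = const_mx 1 :> 'rV_n.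
Proof.
by move=> C1; elim: t => [|t IH]; rewrite ?mulmx1// mpowS mulmxA C1.
Qed.

Lemma mpow_fixed C t (p : 'cV[R]_n) : C *m p = p -> mpow C t *m p = p.
Proof.
by move=> Cp; elim: t => [|t IH]; rewrite ?mul1mx// mpowS -mulmxA IH.
Qed.

(** A path of length m contributes the product of its weights to an entry of the m-th power, and no
    other contribution is negative. *)
Lemma connect_mpow_gt0 C (e : rel 'I_n) r i :
  (forall i j, 0 <= C i j) -> (forall j k, e j k -> 0 < C j k) ->
  connect e r i -> exists m, 0 < mpow C m r i.
Proof.
move=> C0 eC /connectP[p]; elim: p r => [|s p IH] r /=.
  by move=> _ ->; exists 0%N; rewrite /mpow /= mxE eqxx.
move=> /andP[ers ps] /(IH _ ps)[m m0]; exists m.+1.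
rewrite mpowS mxE (bigD1 s)//=; apply: ltr_pwDl.
  by rewrite mulr_gt0// eC.
by apply: sumr_ge0 => k _; rewrite mulr_ge0// mpow_ge0.
Qed.

(** The positive diagonal gives a self-loop at [r], which pads a walk to any larger length. *)
Lemma mpow_gt0_le C r i m m' : (forall i j, 0 <= C i j) -> (forall i, 0 < C i i) ->
  (m <= m')%N -> 0 < mpow C m r i -> 0 < mpow C m' r i.
Proof.
move=> C0 Cd /subnK <-; elim: (m' - m)%N => // k IH /IH h.
rewrite addSn mpowS mxE (bigD1 r)//=; apply: ltr_pwDl; first by rewrite mulr_gt0.
by apply: sumr_ge0 => l _; rewrite mulr_ge0// mpow_ge0.
Qed.

(** Every node is reached from the root; padding all walks to the maximal length gives a single
    exponent. The transpose is there because an edge goes from the column index to the row index. *)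
Lemma root_mpow_gt0 C r : (forall i j, 0 <= C i j) -> (forall i, 0 < C i i) ->
  root_set (induced_edge C^T) r -> exists N, forall i, 0 < mpow C N r i.
Proof.
move=> C0 Cd [T [Te _ Tc]].
have H i : exists m, 0 < mpow C m r i.
  apply: connect_mpow_gt0 (Tc i) => // j k /= /Te.
  by rewrite /induced_edge mxE.
pose f i := xchoose (H i).
exists (\max_i f i)%N => i; apply: (@mpow_gt0_le _ _ _ (f i)) => //.
  exact: leq_bigmax.
exact: (xchooseP (H i)).
Qed.

(** Since p = C^N p, the entry [p r 0] is a combination of all entries of p with positive
    coefficients; if it vanished, p would be zero. *)
Lemma root_eigen_gt0 C N r (p : 'cV[R]_n) : (forall i j, 0 <= C i j) ->
  (forall i, 0 < mpow C N r i) -> (forall i, 0 <= p i 0) ->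
  0 < \sum_i p i 0 -> C *m p = p -> 0 < p r 0.
Proof.
move=> C0 CN p0 sp Cp; rewrite -(mpow_fixed N Cp) mxE.
rewrite lt_neqAle sumr_ge0 ?andbT => [|i _]; last by rewrite mulr_ge0// ltW.
rewrite eq_sym; apply: contraTN sp => /eqP s0; rewrite -leNgt.
apply: sumr_le0 => i _.
have /psumr_eq0P/(_ i isT)/eqP := s0.
rewrite mulf_eq0 gt_eqF//=; move=> h.
by have /eqP -> : p i 0 == 0 by apply: h => k _; rewrite mulr_ge0// ltW.
Qed.

Definition l1norm (x : 'cV[R]_n) := \sum_i `|x i 0|.

(** Doeblin's argument: on a zero-sum vector, subtracting the constant c from row [r] does not
    change the product, and the matrix left over is nonnegative with column sums 1 - c. *)
Lemma l1norm_contract D r (c : R) (x : 'cV[R]_n) :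
  (forall i j, 0 <= D i j) -> const_mx 1 *m D = const_mx 1 :> 'rV_n ->
  (forall j, c <= D r j) -> \sum_i x i 0 = 0 ->
  l1norm (D *m x) <= (1 - c) * l1norm x.
Proof.
move=> D0 D1 Dc sx.
pose D' i j := D i j - c * (i == r)%:R.
have D'0 i j : 0 <= D' i j.
  by rewrite /D' subr_ge0; case: eqVneq => [->|_]; rewrite ?mulr1 ?mulr0.
have -> : l1norm (D *m x) = \sum_i `|\sum_j D' i j * x j 0|.
  apply: eq_bigr => i _; rewrite mxE /D'.
  under [in RHS]eq_bigr do rewrite mulrBl.
  by rewrite sumrB -mulr_sumr sx mulr0 subr0.
apply: (@le_trans _ _ (\sum_i \sum_j D' i j * `|x j 0|)).
  apply: ler_sum => i _; apply: (le_trans (ler_norm_sum _ _ _)).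
  by apply: ler_sum => j _; rewrite normrM ger0_norm.
rewrite exchange_big /= /l1norm mulr_sumr; apply: ler_sum => j _.
rewrite -mulr_suml; apply: ler_wpM2r => //.
have s1 : \sum_(i < n) (i == r)%:R = 1 :> R.
  by rewrite (bigD1 r)//= eqxx big1 ?addr0// => i /negbTE ->.
rewrite /D' sumrB -mulr_sumr s1 mulr1 lerD2r.
have := congr1 (fun M : 'rV_n => M 0 j) D1; rewrite !mxE => <-.
by apply: ler_sum => i _; rewrite mxE mul1r.
Qed.

Lemma l1norm_iter D r (c : R) m (x : 'cV[R]_n) : c <= 1 ->
  (forall i j, 0 <= D i j) -> const_mx 1 *m D = const_mx 1 :> 'rV_n ->
  (forall j, c <= D r j) -> \sum_i x i 0 = 0 ->
  l1norm (mpow D m *m x) <= (1 - c) ^+ m * l1norm x.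
Proof.
move=> c1 D0 D1 Dc sx; elim: m => [|m IH]; first by rewrite mul1mx mul1r.
have s0 : \sum_i (mpow D m *m x) i 0 = 0.
  have := congr1 (fun M : 'rV_n => (M *m x) 0 0) (mpow_col_stochastic m D1).
  rewrite -mulmxA mxE.
  under eq_bigr do rewrite mxE mul1r.
  move=> ->; rewrite mxE -[RHS]sx.
  by apply: eq_bigr => i _; rewrite mxE mul1r.
rewrite mpowS -mulmxA; apply: (le_trans (l1norm_contract D0 D1 Dc s0)).
by rewrite exprS -mulrA; apply: ler_wpM2l; rewrite ?subr_ge0.
Qed.

(** The rank-one part vanishes on zero-sum vectors, and C maps zero-sum vectors to zero-sum
    vectors. *)
Lemma deflated_mpow C (p : 'cV[R]_n) t (x : 'cV[R]_n) :
  const_mx 1 *m C = const_mx 1 :> 'rV_n -> \sum_i x i 0 = 0 ->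
  mpow (C - p *m const_mx 1) t *m x = mpow C t *m x.
Proof.
move=> C1 sx; elim: t => [//|t IH]; rewrite !mpowS -!mulmxA IH mulmxBl.
rewrite -[p *m _ *m _]mulmxA [const_mx 1 *m (_ *m _)]mulmxA mpow_col_stochastic//.
rewrite [const_mx 1 *m x](_ : _ = 0) ?mulmx0 ?subr0//.
apply/matrixP => i j; rewrite !ord1 !mxE -[RHS]sx.
by apply: eq_bigr => k _; rewrite mxE mul1r.
Qed.

(** The columns of the deflated matrix have zero sum because p sums to 1. One factor therefore lands
    in the zero-sum space, where the remaining powers agree with those of C, and blocks of length N
    contract by Doeblin's argument. This one factor is the successor in the exponent. *)
Lemma deflated_mpow_small C r (p : 'cV[R]_n) (e : R) :
  (forall i j, 0 <= C i j) -> (forall i, 0 < C i i) ->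
  const_mx 1 *m C = const_mx 1 :> 'rV_n -> root_set (induced_edge C^T) r ->
  \sum_i p i 0 = 1 -> 0 < e ->
  exists N, forall i j, `|mpow (C - p *m const_mx 1) N.+1 i j| <= e.
Proof.
move=> C0 Cd C1 rr sp e0; have [N CN] := root_mpow_gt0 C0 Cd rr.
pose D := mpow C N.
have D0 : forall i j, 0 <= D i j by exact: mpow_ge0.
have D1 : const_mx 1 *m D = const_mx 1 :> 'rV_n by exact: mpow_col_stochastic.
have [c [c0 c1 Dc]] : exists c, [/\ 0 < c, c <= 1 & forall j, c <= D r j].
  (* The default value 1 of the minimum also yields c <= 1, so that 1 - c is a nonnegative
     factor. *)
  exists (\big[Num.min/1]_j D r j); split.
  - by apply/bigmin_gtP; split=> // j _; exact: CN.
  - exact: bigmin_le_id.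
  - by move=> j; exact: bigmin_le_cond.
pose St := C - p *m const_mx 1.
pose K := \sum_j l1norm (col j St) + 1.
have K0 : 0 < K.
  rewrite ltr_wpDl//; apply: sumr_ge0 => j _; exact: sumr_ge0.
have : (fun m => (1 - c) ^+ m) @ \oo --> (0 : R).
  by apply: cvg_expr; rewrite ger0_norm ?subr_ge0// gtrBl.
move/cvgrPdist_le => /(_ (e / K)); rewrite divr_gt0// => /(_ isT)[m _ hm].
have {}hm : (1 - c) ^+ m <= e / K.
  have := hm m (leqnn _); rewrite sub0r normrN ger0_norm//.
  by rewrite exprn_ge0// subr_ge0.
exists (N * m)%N => i j.
have sc : \sum_i col j St i 0 = 0.
  have : (const_mx 1 : 'rV_n) *m St = 0.
    rewrite mulmxBr C1 mulmxA [_ *m p](_ : _ = 1%:M) ?mul1mx ?subrr//.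
    apply/matrixP => a b; rewrite !ord1 !mxE -[RHS]/(1 : R) -[RHS]sp.
    by apply: eq_bigr => k _; rewrite mxE mul1r.
  move/(congr1 (fun M : 'rV_n => M 0 j)); rewrite [RHS]mxE; apply: etrans.
  rewrite [RHS]mxE; apply: eq_bigr => k _.
  by rewrite [col _ _ _ _]mxE [const_mx _ _ _]mxE mul1r.
rewrite mpowSr.
have -> : (mpow St (N * m) *m St) i j = (mpow St (N * m) *m col j St) i 0.
  by rewrite !mxE; apply: eq_bigr => k _; rewrite [in RHS]mxE.
rewrite deflated_mpow// mpow_mul -/D.
apply: (@le_trans _ _ (l1norm (mpow D m *m col j St))).
  by rewrite /l1norm (bigD1 i)//= lerDl; apply: sumr_ge0.
apply: (le_trans (l1norm_iter m c1 D0 D1 Dc sc)).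
have hK : l1norm (col j St) <= K.
  rewrite /K (bigD1 j)//= -addrA lerDl addr_ge0//.
  by apply: sumr_ge0 => k _; exact: sumr_ge0.
apply: (@le_trans _ _ (e / K * K)); last by rewrite divfK// gt_eqF.
apply: ler_pM => //; first by rewrite exprn_ge0// subr_ge0.
exact: sumr_ge0.
Qed.

(** A row vector in the left kernel of I - S is fixed by every power of S, hence is zero as soon as
    one power is small enough. *)
Lemma deflated_unitmx S : (forall e : R, 0 < e -> exists N, forall i j, `|mpow S N.+1 i j| <= e) ->
  1%:M - S \in unitmx.
Proof.
move=> small; rewrite -row_free_unit -kermx_eq0; apply/eqP/row_matrixP => a.
rewrite row0; set w := row a _.
have wS : w = w *m S.
  have : w *m (1%:M - S) = 0 by rewrite -row_mul mulmx_ker row0.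
  by rewrite mulmxBr mulmx1 => /eqP; rewrite subr_eq0 => /eqP.
have wSN N : w *m mpow S N = w.
  by elim: N => [|N IH]; rewrite ?mulmx1// mpowS mulmxA -wS.
pose s := \sum_i `|w 0 i|.
have s0 : 0 <= s by exact: sumr_ge0.
(* With entries below this threshold, summing over n columns gives s <= s / 2. Using n + 1 instead
   of n avoids a division by zero. *)
have e0 : 0 < (2 * n.+1%:R)^-1 :> R by rewrite invr_gt0 mulr_gt0.
have [N hN] := small _ e0.
have bnd j : `|w 0 j| <= s / (2 * n.+1%:R).
  rewrite -(wSN N.+1) mxE; apply: (le_trans (ler_norm_sum _ _ _)).
  rewrite /s mulr_suml; apply: ler_sum => i _; rewrite normrM.
  by apply: ler_wpM2l; [exact: normr_ge0|exact: hN].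
have : s <= s / 2.
  apply: (@le_trans _ _ (\sum_(j < n) s / (2 * n.+1%:R))).
    by apply: ler_sum => j _; exact: bnd.
  rewrite sumr_const card_ord -[_ *+ n]mulr_natr -mulrA; apply: ler_wpM2l => //.
  rewrite invfM -mulrA -[leRHS]mulr1 ler_pM2l ?invr_gt0//.
  by rewrite mulrC ler_pdivrMr// mul1r ler_nat.
move=> ss; have {}s0 : s = 0 by lra.
apply/rowP => j; rewrite [RHS]mxE; apply/eqP; rewrite -normr_le0.
by rewrite -s0 /s (bigD1 j)//= lerDl; exact: sumr_ge0.
Qed.

End MatrixPowers.

(** * Squared Frobenius norms and contracted quadratic forms *)

Section Frobenius.
Variable R : realType.

Definition fro2 m p (M : 'M[R]_(m, p)) : R := \sum_i \sum_j M i j ^+ 2.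

Section Basics.
Variables m p : nat.
Implicit Types M N : 'M[R]_(m, p).

Lemma fro2_ge0 M : 0 <= fro2 M.
Proof. by apply: sumr_ge0 => i _; apply: sumr_ge0 => j _; exact: sqr_ge0. Qed.

Lemma fro2Z c M : fro2 (c *: M) = c ^+ 2 * fro2 M.
Proof.
rewrite /fro2 mulr_sumr; apply: eq_bigr => i _.
by rewrite mulr_sumr; apply: eq_bigr => j _; rewrite mxE exprMn.
Qed.

Lemma fro2N M : fro2 (- M) = fro2 M.
Proof. by rewrite -scaleN1r fro2Z sqrrN expr1n mul1r. Qed.

Lemma fro2_young (h : R) M N : 0 < h ->
  fro2 (M + N) <= (1 + h) * fro2 M + (1 + h^-1) * fro2 N.
Proof.
move=> h0; rewrite /fro2 !mulr_sumr -big_split /=; apply: ler_sum => i _.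
rewrite !mulr_sumr -big_split /=; apply: ler_sum => j _; rewrite mxE.
set a := M i j; set b := N i j.
rewrite -subr_ge0.
have -> : (1 + h) * a ^+ 2 + (1 + h^-1) * b ^+ 2 - (a + b) ^+ 2 =
    h^-1 * (h * a - b) ^+ 2 by field; rewrite gt_eqF.
by rewrite mulr_ge0 ?sqr_ge0// invr_ge0 ltW.
Qed.

Lemma fro2D M N : fro2 (M + N) <= 2 * fro2 M + 2 * fro2 N.
Proof. by have := @fro2_young 1 M N ltr01; rewrite invr1. Qed.

End Basics.

(** Cauchy-Schwarz, read off from Lagrange's identity: twice the gap is the double sum of the
    squares (a_i b_j - a_j b_i)^2. *)
Lemma sumr_sqr_le (I : finType) (a b : I -> R) :
  (\sum_i a i * b i) ^+ 2 <= (\sum_i a i ^+ 2) * (\sum_i b i ^+ 2).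
Proof.
have h : 0 <= \sum_i \sum_j (a i * b j - a j * b i) ^+ 2.
  by apply: sumr_ge0 => i _; apply: sumr_ge0 => j _; exact: sqr_ge0.
have E : \sum_i \sum_j (a i * b j - a j * b i) ^+ 2 =
    2 * ((\sum_i a i ^+ 2) * (\sum_i b i ^+ 2)) - 2 * (\sum_i a i * b i) ^+ 2.
  have e1 : \sum_i \sum_j a i ^+ 2 * b j ^+ 2 =
      (\sum_i a i ^+ 2) * (\sum_i b i ^+ 2) by rewrite big_distrlr.
  have e2 : \sum_i \sum_j a j ^+ 2 * b i ^+ 2 =
      (\sum_i a i ^+ 2) * (\sum_i b i ^+ 2) by rewrite exchange_big /= e1.
  have e3 : \sum_i \sum_j (a i * b i) * (a j * b j) = (\sum_i a i * b i) ^+ 2.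
    by rewrite expr2 big_distrlr.
  rewrite mulr2n mulrDl mul1r -{1}e1 -e2 -e3 mulr_sumr -big_split /= -sumrB.
  apply: eq_bigr => i _; rewrite mulr_sumr -big_split /= -sumrB.
  by apply: eq_bigr => j _; ring.
by move: h; rewrite E -mulrBr pmulr_rge0// subr_ge0.
Qed.

Lemma fro2_mulmx m n p (S : 'M[R]_(m, n)) (M : 'M[R]_(n, p)) :
  fro2 (S *m M) <= fro2 S * fro2 M.
Proof.
rewrite /fro2 mulr_suml; apply: ler_sum => i _.
rewrite exchange_big /= mulr_sumr; apply: ler_sum => j _.
by rewrite mxE; exact: sumr_sqr_le.
Qed.

Lemma dotv_young d (h : R) (x y : 'rV[R]_d) : 0 < h ->
  2 * dotv x y <= h * fro2 x + h^-1 * fro2 y.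
Proof.
move=> h0; rewrite /fro2 !big_ord1 !mulr_sumr -big_split /=.
apply: ler_sum => j _; set a := x 0 j; set b := y 0 j; rewrite -subr_ge0.
have -> : h * a ^+ 2 + h^-1 * b ^+ 2 - 2 * (a * b) =
    h^-1 * (h * a - b) ^+ 2 by field; rewrite gt_eqF.
by rewrite mulr_ge0 ?sqr_ge0// invr_ge0 ltW.
Qed.

Lemma fro2_rowD d (x y : 'rV[R]_d) : fro2 (x + y) = fro2 x + 2 * dotv x y + fro2 y.
Proof.
rewrite /fro2 !big_ord1 mulr_sumr -!big_split /=; apply: eq_bigr => j _.
by rewrite mxE; ring.
Qed.

Lemma enorm_fro2 d (x : 'rV[R]_d) : enorm x ^+ 2 = fro2 x.
Proof.
rewrite /fro2 big_ord1 sqr_sqrtr; first by apply: eq_bigr => j _; rewrite expr2.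
by apply: sumr_ge0 => j _; rewrite -expr2 sqr_ge0.
Qed.

Section Lyapunov.
Variables n d : nat.
Implicit Types S : 'M[R]_n.

(* Truncation of the quadratic form solving the discrete Lyapunov equation
   [Q (S M) = Q M - fro2 M]. *)
Definition qsum S N (M : 'M[R]_(n, d)) : R := \sum_(t < N) fro2 (mpow S t *m M).

Lemma qsum_ge0 S N M : 0 <= qsum S N M.
Proof. by apply: sumr_ge0 => t _; exact: fro2_ge0. Qed.

(** Replacing M by S M shifts the sum: it loses the term [fro2 M] and gains that of the power N + 1,
    which is at most half of it. As the form is also bounded by a multiple K of [fro2 M], the loss
    is a fixed fraction of the form. Young's inequality then admits the perturbation E. *)
Lemma qsum_contract S :
  (forall e : R, 0 < e -> exists N, forall i j, `|mpow S N.+1 i j| <= e) ->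
  exists N (r C : R), [/\ 0 <= r, r < 1, 0 < C, forall M, fro2 M <= qsum S N M
    & forall M E, qsum S N (S *m M + E) <= r * qsum S N M + C * fro2 E].
Proof.
move=> small.
have e0 : 0 < (2 * n.+1%:R)^-1 :> R by rewrite invr_gt0 mulr_gt0.
have [N hN] := small _ e0.
have half : fro2 (mpow S N.+1) <= 1 / 2.
  apply: (@le_trans _ _ (\sum_(i < n) \sum_(j < n) ((2 * n.+1%:R)^-1) ^+ 2)).
    apply: ler_sum => i _; apply: ler_sum => j _.
    by rewrite -real_normK ?num_real// ler_pXn2r// nnegrE ltW.
  rewrite !sumr_const !card_ord -mulrnA -[_ *+ (n * n)]mulr_natr natrM.
  rewrite exprVn ler_pdivrMl ?exprn_gt0 ?mulr_gt0//.
  have : n%:R <= n.+1%:R :> R by rewrite ler_nat.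
  have : 0 <= n%:R :> R by [].
  by move: (n%:R) (n.+1%:R) => x y x0 xy; nra.
pose K := \sum_(t < N.+1) fro2 (mpow S t) + 1.
have K1 : 1 <= K by rewrite lerDr; apply: sumr_ge0 => t _; exact: fro2_ge0.
have QK M : qsum S N.+1 M <= K * fro2 M.
  rewrite mulrDl mul1r mulr_suml -[leLHS]addr0; apply: lerD; last exact: fro2_ge0.
  by apply: ler_sum => t _; exact: fro2_mulmx.
have Qge M : fro2 M <= qsum S N.+1 M.
  rewrite /qsum big_ord_recl mul1mx lerDl.
  by apply: sumr_ge0 => t _; exact: fro2_ge0.
have QS M : qsum S N.+1 (S *m M) <= qsum S N.+1 M - 1 / 2 * fro2 M.
  have -> : qsum S N.+1 (S *m M) =
      qsum S N.+1 M - fro2 M + fro2 (mpow S N.+1 *m M).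
    rewrite /qsum [in RHS]big_ord_recl mul1mx [fro2 M + _]addrC addrK.
    rewrite -(big_ord_recr N (fun t : 'I_N.+1 => fro2 (mpow S t.+1 *m M))).
    by apply: eq_bigr => t _; rewrite mulmxA -mpowSr.
  have := fro2_mulmx (mpow S N.+1) M.
  have := ler_wpM2r (fro2_ge0 M) half.
  lra.
(* This h serves twice: h K = 1/2 turns the loss of half of [fro2 M] into the factor 1 - h, and
   Young's inequality with the same h costs 1 + h, so the product 1 - h^2 is still below 1. *)
pose h := (2 * K)^-1.
have K0 : 0 < K by exact: lt_le_trans K1.
have h0 : 0 < h by rewrite invr_gt0 mulr_gt0.
have h1 : h < 1 by rewrite invf_lt1 ?mulr_gt0//; lra.
have hK : h * K = 1 / 2 by rewrite /h; field; rewrite gt_eqF.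
exists N.+1, (1 - h ^+ 2), ((1 + h^-1) * K); split => //.
- by rewrite subr_ge0 exprn_ile1// ltW.
- by rewrite gtrBl exprn_gt0.
- by rewrite mulr_gt0// ltr_wpDl// invr_gt0.
move=> M E.
apply: (@le_trans _ _ ((1 + h) * qsum S N.+1 (S *m M) + (1 + h^-1) * qsum S N.+1 E)).
  rewrite /qsum !mulr_sumr -big_split /=; apply: ler_sum => t _.
  by rewrite mulmxDr; exact: fro2_young.
apply: lerD; last first.
  by rewrite -mulrA; apply: ler_wpM2l; rewrite ?addr_ge0// invr_ge0 ltW.
have : qsum S N.+1 (S *m M) <= (1 - h) * qsum S N.+1 M.
  apply: (le_trans (QS M)).
  have := ler_wpM2l (ltW h0) (QK M); rewrite mulrA hK.
  lra.
have h01 : 0 <= 1 + h by rewrite addr_ge0// ltW.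
move/(ler_wpM2l h01); rewrite mulrA.
by have -> : (1 + h) * (1 - h) = 1 - h ^+ 2 by ring.
Qed.

End Lyapunov.
End Frobenius.

(** * One step of the iteration *)

Section Network.
Variables (R : realType) (n : nat).
Hypothesis n_gt0 : (0 < n)%N.
Variables (A B : 'M[R]_n) (u : 'rV[R]_n) (v : 'cV[R]_n).
Hypothesis net : network_assumption A B.
Hypothesis u_ge0 : forall i, 0 <= u 0 i.
Hypothesis u_eigen : u *m A = u.
Hypothesis u_sum : \sum_(i < n) u 0 i = n%:R.
Hypothesis v_ge0 : forall i, 0 <= v i 0.
Hypothesis v_eigen : B *m v = v.
Hypothesis v_sum : \sum_(i < n) v i 0 = n%:R.

Let nR_gt0 : 0 < n%:R :> R. Proof. by rewrite ltr0n. Qed.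
Let nR_neq0 : n%:R != 0 :> R. Proof. by rewrite gt_eqF. Qed.

Definition weight : R := (u *m v) 0 0.
Definition ubar : 'rV[R]_n := n%:R^-1 *: u.
Definition vbar : 'cV[R]_n := n%:R^-1 *: v.
Definition Adefl : 'M[R]_n := A - const_mx 1 *m ubar.
Definition Bdefl : 'M[R]_n := B - vbar *m const_mx 1.

Lemma ubar1 : ubar *m (const_mx 1 : 'cV_n) = 1%:M.
Proof.
apply/matrixP => i j; rewrite !ord1 !mxE -[RHS]/(1 : R).
under eq_bigr do rewrite !mxE mulr1.
by rewrite -mulr_sumr u_sum mulVf.
Qed.

Lemma vbar1 : (const_mx 1 : 'rV_n) *m vbar = 1%:M.
Proof.
apply/matrixP => i j; rewrite !ord1 !mxE -[RHS]/(1 : R).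
under eq_bigr do rewrite !mxE mul1r.
by rewrite -mulr_sumr v_sum mulVf.
Qed.

Lemma ubarA : ubar *m A = ubar.
Proof. by rewrite -scalemxAl u_eigen. Qed.

Lemma vbarB : B *m vbar = vbar.
Proof. by rewrite -scalemxAr v_eigen. Qed.

(** Obtained from the column-stochastic case by transposition, with [ubar^T] in the role of p. *)
Lemma Adefl_small (e : R) : 0 < e ->
  exists N, forall i j, `|mpow Adefl N.+1 i j| <= e.
Proof.
move=> e0; have [r [rA _]] := net_common_root net.
have AT1 : const_mx 1 *m A^T = const_mx 1 :> 'rV_n.
  by rewrite -[const_mx 1]trmx_const -trmx_mul (net_A_row_stochastic net) trmx_const.
have [||||N hN] := @deflated_mpow_small _ _ A^T r ubar^T e _ _ AT1 _ _ e0.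
- by move=> i j; rewrite mxE; exact: net_A_ge0 net _ _.
- by move=> i; rewrite mxE; exact: net_A_diag_gt0 net _.
- by rewrite trmxK.
- under eq_bigr do rewrite !mxE.
  by rewrite -mulr_sumr u_sum mulVf.
exists N => i j; rewrite -[mpow _ _]trmxK mxE mpow_tr.
rewrite (_ : Adefl^T = A^T - ubar^T *m const_mx 1); first exact: hN.
by rewrite /Adefl linearB /= trmx_mul trmx_const.
Qed.

Lemma Bdefl_small (e : R) : 0 < e ->
  exists N, forall i j, `|mpow Bdefl N.+1 i j| <= e.
Proof.
move=> e0; have [r [_ rB]] := net_common_root net.
apply: (deflated_mpow_small _ _ (net_B_col_stochastic net) rB) => //.
- exact: net_B_ge0 net.
- exact: net_B_diag_gt0 net.
- under eq_bigr do rewrite !mxE.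
  by rewrite -mulr_sumr v_sum mulVf.
Qed.

(** A common root r has both u_r > 0 and v_r > 0, and the remaining terms of the scalar product are
    nonnegative. *)
Lemma weight_gt0 : 0 < weight.
Proof.
have [r [rA rB]] := net_common_root net.
have vr : 0 < v r 0.
  have [N hN] := root_mpow_gt0 (net_B_ge0 net) (net_B_diag_gt0 net) rB.
  by apply: (root_eigen_gt0 (net_B_ge0 net) hN) => //; rewrite v_sum.
have ur : 0 < u^T r 0.
  have A0 i j : 0 <= A^T i j by rewrite mxE; exact: net_A_ge0 net _ _.
  have Ad i : 0 < A^T i i by rewrite mxE; exact: net_A_diag_gt0 net _.
  have [|N hN] := @root_mpow_gt0 _ _ A^T r A0 Ad; first by rewrite trmxK.
  apply: (root_eigen_gt0 A0 hN); first by move=> i; rewrite mxE.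
    by under eq_bigr do rewrite mxE; rewrite u_sum.
  by rewrite -trmx_mul u_eigen.
rewrite /weight mxE (bigD1 r)//=; apply: ltr_pwDl.
  by rewrite mulr_gt0//; rewrite mxE in ur.
by apply: sumr_ge0 => i _; rewrite mulr_ge0.
Qed.

(** The matrix I - B is singular, but I - [Bdefl] is invertible. The solution q of the deflated
    equation satisfies q vbar = 0, because the right-hand side w annihilates vbar and
    [Bdefl *m vbar] is zero; hence it also solves the original equation. *)
Lemma correction_exists : exists q : 'rV[R]_n,
  q *m (B - 1%:M) = u - (weight / n%:R) *: const_mx 1.
Proof.
have U : 1%:M - Bdefl \in unitmx by apply: deflated_unitmx; exact: Bdefl_small.
set w : 'rV_n := u - _.
pose q := - (w *m invmx (1%:M - Bdefl)).
have qE : q *m (1%:M - Bdefl) = - w by rewrite mulNmx mulmxKV.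
have wv : w *m vbar = 0.
  rewrite mulmxBl -scalemxAl vbar1 /vbar -scalemxAr.
  apply/matrixP => i j; rewrite !ord1 !mxE -[(0 == 0)%:R]/(1 : R) mulr1 [_ / _]mulrC.
  by rewrite /weight mxE subrr.
have qv : q *m vbar = 0.
  have : q *m (1%:M - Bdefl) *m vbar = 0 by rewrite qE mulNmx wv oppr0.
  rewrite -mulmxA mulmxBl mul1mx [Bdefl *m _]mulmxBl vbarB -[vbar *m _ *m _]mulmxA vbar1.
  by rewrite mulmx1 subrr subr0.
exists q; move: qE; rewrite /Bdefl !mulmxBr mulmx1 mulmxA qv mul0mx subr0.
by move/eqP; rewrite -eqr_opp opprK opprB => /eqP.
Qed.

(** * Effect of one step on the corrected average, the disagreement and the tracker *)

Section OneStep.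
Variable d : nat.
Variables (q : 'rV[R]_n) (xstar : 'rV[R]_d).
Hypothesis qE : q *m (B - 1%:M) = u - (weight / n%:R) *: const_mx 1.
Implicit Types (X T G : 'M[R]_(n, d)) (al : R).

(* [T] is the tracker minus the sampled gradients, T_k = y_k - G_k: unlike y_k,
   it does not depend on the sample drawn at time k. *)
Definition next_X al X T G : 'M[R]_(n, d) := A *m X - al *: (T + G).
Definition next_T T G : 'M[R]_(n, d) := B *m (T + G) - G.
Definition disagreement X : 'M[R]_(n, d) := X - const_mx 1 *m (ubar *m X).
(* By the equation for [q], [u *m y_k] is [weight / n] times the sum of the
   sampled gradients plus the increment of [q *m T]; the correction term absorbs
   this increment, i.e. the tracking error, which does not vanish by itself. *)
Definition corrected al X T : 'rV[R]_d := ubar *m X + (al / n%:R) *: (q *m T).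

Local Notation csum M := ((const_mx 1 : 'rV[R]_n) *m M).

Lemma next_TE T G : next_T T G = B *m T + (B - 1%:M) *m G.
Proof. by rewrite /next_T mulmxDr mulmxBl mul1mx addrA. Qed.

(** The increment of T is (B - I)(T + G), so the equation for q expresses the increment of q T as u
    (T + G) minus a multiple of the column sums of T + G. The first part cancels the tracker term of
    the average, and the column sums of T are zero. *)
Lemma corrected_next al al' X T G : csum T = 0 ->
  corrected al' (next_X al X T G) (next_T T G) =
  corrected al X T - (al * weight / n%:R ^+ 2) *: csum G
  + ((al' - al) / n%:R) *: (q *m next_T T G).
Proof.
move=> T0.
have qT : q *m next_T T G = q *m T + u *m (T + G) - (weight / n%:R) *: (const_mx 1 *m G).
  have -> : next_T T G = T + (B - 1%:M) *m (T + G).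
    rewrite /next_T mulmxBl mul1mx; set Y := B *m _.
    by apply/matrixP => i j; rewrite !mxE; ring.
  rewrite mulmxDr mulmxA qE mulmxBl -scalemxAl [const_mx 1 *m (T + G)]mulmxDr T0 add0r.
  by rewrite addrA.
have xE : ubar *m next_X al X T G = ubar *m X - (al / n%:R) *: (u *m (T + G)).
  rewrite /next_X mulmxBr mulmxA ubarA -scalemxAr /ubar -!scalemxAl scalerA.
  by rewrite mulrC.
rewrite /corrected xE qT.
set a := ubar *m X; set b := u *m (T + G); set c := q *m T; set s := const_mx 1 *m G.
apply/rowP => j; rewrite !mxE; field.
by rewrite nR_neq0.
Qed.

(** With Pi the consensus projector [const_mx 1 *m ubar], the relations A 1 = 1 and ubar A = ubar
    give (I - Pi) A = (A - Pi)(I - Pi). *)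
Lemma disagreement_next al X T G :
  disagreement (next_X al X T G) = Adefl *m disagreement X +
    - (al *: ((1%:M - const_mx 1 *m ubar) *m (T + G))).
Proof.
have A1 := net_A_row_stochastic net.
have dE Y : disagreement Y = (1%:M - const_mx 1 *m ubar) *m Y.
  by rewrite /disagreement mulmxBl mul1mx mulmxA.
rewrite !dE /next_X /Adefl; move: ubar ubarA ubar1 => w wA w1.
rewrite mulmxBr -scalemxAr; congr (_ - _).
rewrite !mulmxA; congr (_ *m X).
rewrite !(mulmxBl, mulmxBr) !mulmx1 !mul1mx !mulmxA A1.
rewrite -[const_mx 1 *m w *m A]mulmxA wA.
rewrite -[const_mx 1 *m w *m const_mx 1]mulmxA w1 mulmx1.
by rewrite subrr subr0.
Qed.

Lemma next_T_deflated T G : csum T = 0 ->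
  next_T T G = Bdefl *m T + (B - 1%:M) *m G.
Proof.
move=> T0; rewrite next_TE; congr (_ + _).
by rewrite /Bdefl mulmxBl -mulmxA T0 mulmx0 subr0.
Qed.

Lemma fro2_next_T T G :
  fro2 (next_T T G) <= 2 * (fro2 B + fro2 (B - 1%:M)) * (fro2 T + fro2 G).
Proof.
rewrite next_TE; apply: (le_trans (fro2D _ _)).
have h1 := fro2_mulmx B T; have h2 := fro2_mulmx (B - 1%:M) G.
have := fro2_ge0 B; have := fro2_ge0 (B - 1%:M).
have := fro2_ge0 T; have := fro2_ge0 G.
move: (fro2 B) (fro2 (B - _)) (fro2 T) (fro2 G) h1 h2 => b c t g.
move=> h1 h2 g0 t0 c0 b0.
have := mulr_ge0 b0 g0; have := mulr_ge0 c0 t0; lra.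
Qed.

Lemma disagreement_drift N (r C0 : R) : 0 < C0 ->
  (forall M E : 'M[R]_(n, d), qsum Adefl N (Adefl *m M + E) <= r * qsum Adefl N M + C0 * fro2 E) ->
  exists2 C, 0 <= C & forall al X T G,
    qsum Adefl N (disagreement (next_X al X T G)) <=
      r * qsum Adefl N (disagreement X) + C * al ^+ 2 * (fro2 T + fro2 G).
Proof.
move=> C00 h; pose Pr : 'M[R]_n := 1%:M - const_mx 1 *m ubar.
exists (2 * C0 * fro2 Pr); first by rewrite !mulr_ge0 ?fro2_ge0// ltW.
move=> al X T G; rewrite disagreement_next; apply: (le_trans (h _ _)).
rewrite lerD2l fro2N fro2Z -/Pr.
have h1 := fro2_mulmx Pr (T + G); have h2 := fro2D T G.
have h3 := ler_wpM2l (fro2_ge0 Pr) h2.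
have h4 := le_trans h1 h3.
have c0 : 0 <= C0 * al ^+ 2 by rewrite mulr_ge0 ?sqr_ge0// ltW.
have := ler_wpM2l c0 h4.
lra.
Qed.

(** In contrast with the disagreement, the noise term here has no factor [al ^+ 2]; the weight in
    the Lyapunov function supplies it. *)
Lemma tracker_drift N (r C0 : R) : 0 < C0 ->
  (forall M E : 'M[R]_(n, d), qsum Bdefl N (Bdefl *m M + E) <= r * qsum Bdefl N M + C0 * fro2 E) ->
  exists2 C, 0 <= C & forall T G, csum T = 0 ->
    qsum Bdefl N (next_T T G) <= r * qsum Bdefl N T + C * fro2 G.
Proof.
move=> C00 h; exists (C0 * fro2 (B - 1%:M)); first by rewrite mulr_ge0 ?fro2_ge0// ltW.
move=> T G T0; rewrite next_T_deflated//; apply: (le_trans (h _ _)).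
rewrite lerD2l -mulrA; apply: ler_wpM2l; first exact: ltW.
exact: fro2_mulmx.
Qed.

Lemma dotvDr (x y z : 'rV[R]_d) : dotv x (y + z) = dotv x y + dotv x z.
Proof. by rewrite /dotv -big_split /=; apply: eq_bigr => j _; rewrite mxE mulrDr. Qed.

Lemma dotvZr c (x y : 'rV[R]_d) : dotv x (c *: y) = c * dotv x y.
Proof. by rewrite /dotv mulr_sumr; apply: eq_bigr => j _; rewrite mxE mulrCA. Qed.

(** The step is a gradient move plus a remainder ep, whose square is of order al^4 because the
    step-size decreases by at most K al^2. All products involving ep are thus of order al^2, up to
    the growth factor 1 + al^2. *)
Lemma error_drift (K : R) : 0 <= K -> exists2 C, 0 <= C & forall al al' X T G,
  0 < al -> al <= 1 -> al' <= al -> al - al' <= K * al ^+ 2 -> csum T = 0 ->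
  fro2 (corrected al' (next_X al X T G) (next_T T G) - xstar) <=
    (1 + al ^+ 2) * fro2 (corrected al X T - xstar)
    - 2 * (al * weight / n%:R ^+ 2) * dotv (corrected al X T - xstar) (csum G)
    + C * al ^+ 2 * (fro2 T + fro2 G).
Proof.
move=> K0; pose b := 2 * (fro2 B + fro2 (B - 1%:M)).
have b0 : 0 <= b by rewrite mulr_ge0// addr_ge0// fro2_ge0.
pose CE := K ^+ 2 * fro2 q * b.
have CE0 : 0 <= CE.
  by apply: mulr_ge0 => //; apply: mulr_ge0; [exact: sqr_ge0|exact: fro2_ge0].
pose w := weight / n%:R ^+ 2.
pose c1 := fro2 (const_mx 1 : 'rV[R]_n).
pose CG := 2 * w ^+ 2 * c1.
have CG0 : 0 <= CG.
  by apply: mulr_ge0; [apply: mulr_ge0 => //; exact: sqr_ge0|exact: fro2_ge0].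
(* Two copies of CE come from splitting the square of gradient move plus remainder, the third from
   the cross term of the remainder with the error. *)
exists (3 * CE + CG); first by rewrite addr_ge0// mulr_ge0.
move=> al al' X T G al0 al1 al'al alK T0.
set a := corrected al X T - xstar.
have al20 : 0 <= al ^+ 2 by exact: sqr_ge0.
have al21 : al ^+ 2 <= 1 by rewrite exprn_ile1// ltW.
rewrite corrected_next//.
set ep := ((al' - al) / n%:R) *: (q *m _); set s := csum G.
rewrite (_ : _ - xstar = a + (- (al * w) *: s + ep)); last first.
  rewrite /a /w -[al * weight / _]mulrA; move: (corrected al X T) (s) (ep) => z s' ep'.
  by apply/rowP => j; rewrite !mxE; ring.
rewrite fro2_rowD dotvDr dotvZr.
have he : fro2 ep <= al ^+ 2 * al ^+ 2 * CE * (fro2 T + fro2 G).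
  rewrite /ep fro2Z.
  have h1 : ((al' - al) / n%:R) ^+ 2 <= (K * al ^+ 2) ^+ 2.
    have hK : 0 <= K * al ^+ 2 by exact: mulr_ge0.
    rewrite -real_normK ?num_real// ler_pXn2r ?nnegrE ?normr_ge0//.
    rewrite normrM distrC [`|n%:R^-1|]ger0_norm ?invr_ge0// ger0_norm ?subr_ge0//.
    apply: le_trans alK; apply: ler_piMr; first by rewrite subr_ge0.
    by rewrite invf_le1// ler1n.
  have h2 : fro2 (q *m next_T T G) <= fro2 q * (b * (fro2 T + fro2 G)).
    apply: (le_trans (fro2_mulmx _ _)); apply: ler_wpM2l; first exact: fro2_ge0.
    exact: fro2_next_T.
  apply: (@le_trans _ _ ((K * al ^+ 2) ^+ 2 * (fro2 q * (b * (fro2 T + fro2 G))))).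
    exact: (ler_pM (sqr_ge0 _) (fro2_ge0 _) h1 h2).
  by rewrite le_eqVlt; apply/orP; left; apply/eqP; rewrite /CE; ring.
have hs : fro2 (- (al * w) *: s + ep) <= al ^+ 2 * CG * fro2 G + 2 * fro2 ep.
  apply: (le_trans (fro2D _ _)); rewrite lerD2r fro2Z sqrrN.
  have h1 : fro2 s <= c1 * fro2 G by exact: fro2_mulmx.
  have := ler_wpM2l (sqr_ge0 (al * w)) h1.
  rewrite /CG exprMn; lra.
(* Young's inequality with parameter al^2: dividing the al^4 of the remainder by al^2 still leaves
   al^2. *)
have hd : 2 * dotv a ep <= al ^+ 2 * fro2 a + al ^+ 2 * CE * (fro2 T + fro2 G).
  apply: (le_trans (dotv_young a ep (exprn_gt0 2 al0))); rewrite lerD2l.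
  rewrite ler_pdivrMl ?exprn_gt0//; apply: (le_trans he).
  by move: (al ^+ 2) (CE) (_ + _) => x y z; rewrite !mulrA.
have g0 := fro2_ge0 G; have t0 := fro2_ge0 T.
have he' : fro2 ep <= al ^+ 2 * CE * (fro2 T + fro2 G).
  apply: (le_trans he); apply: ler_wpM2r; first exact: addr_ge0.
  by apply: ler_wpM2r => //; exact: ler_piMl.
rewrite -[al * weight / _]mulrA -/w.
have : 0 <= al ^+ 2 * CG * fro2 T by do 2 apply: mulr_ge0 => //.
lra.
Qed.

(** Gradients are sampled at the rows of X, whereas descent is measured at the corrected average;
    this bounds the mismatch. *)
Lemma spread_bound : exists2 C, 0 <= C & forall al X T,
  fro2 (X - const_mx 1 *m (corrected al X T)) <=
    C * (fro2 (disagreement X) + al ^+ 2 * fro2 T).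
Proof.
pose c := fro2 ((const_mx 1 : 'cV_n) *m q).
have c0 : 0 <= c by exact: fro2_ge0.
exists (2 + 2 * c); first by rewrite addr_ge0// mulr_ge0.
move=> al X T.
have -> : X - const_mx 1 *m corrected al X T =
    disagreement X + - ((al / n%:R) *: (const_mx 1 *m q *m T)).
  by rewrite /corrected mulmxDr opprD addrA -/(disagreement X) -scalemxAr mulmxA.
apply: (le_trans (fro2D _ _)); rewrite fro2N fro2Z.
have h : fro2 ((const_mx 1 : 'cV_n) *m q *m T) <= c * fro2 T by exact: fro2_mulmx.
have hn : (al / n%:R) ^+ 2 <= al ^+ 2.
  rewrite exprMn; apply: ler_piMr; first exact: sqr_ge0.
  by rewrite exprn_ile1 ?invr_ge0// invf_le1// ler1n.
have h2 : (al / n%:R) ^+ 2 * fro2 ((const_mx 1 : 'cV_n) *m q *m T) <= al ^+ 2 * (c * fro2 T).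
  exact: (ler_pM (sqr_ge0 _) (fro2_ge0 _) hn h).
have x0 := fro2_ge0 (disagreement X).
have := mulr_ge0 c0 x0; have := mulr_ge0 (sqr_ge0 al) (fro2_ge0 T).
lra.
Qed.

(** The second moment of the sampled gradients grows with the distance of the rows from [xstar];
    here this distance is expressed by the ingredients of the Lyapunov function. *)
Lemma distance_bound : exists2 C, 0 <= C & forall al X T,
  fro2 (X - const_mx 1 *m xstar) <=
    C * (fro2 (corrected al X T - xstar) + fro2 (disagreement X) + al ^+ 2 * fro2 T).
Proof.
have [C C0 hC] := spread_bound.
pose c := fro2 (const_mx 1 : 'cV[R]_n).
have c0 : 0 <= c by exact: fro2_ge0.
exists (2 * C + 2 * c); first by rewrite addr_ge0// mulr_ge0.
move=> al X T; set z := corrected al X T.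
have -> : X - const_mx 1 *m xstar =
    (X - const_mx 1 *m z) + const_mx 1 *m (z - xstar).
  by rewrite mulmxBr addrA subrK.
apply: (le_trans (fro2D _ _)).
have h1 := hC al X T; rewrite -/z in h1.
have h2 : fro2 ((const_mx 1 : 'cV_n) *m (z - xstar)) <= c * fro2 (z - xstar).
  exact: fro2_mulmx.
have t0 := mulr_ge0 (sqr_ge0 al) (fro2_ge0 T).
have x0 := fro2_ge0 (disagreement X); have z0 := fro2_ge0 (z - xstar).
have := mulr_ge0 c0 t0; have := mulr_ge0 c0 x0; have := mulr_ge0 C0 z0.
lra.
Qed.

(** Removes the correction at the end: the actual average differs from the corrected one by a term
    of order al T. *)
Lemma average_bound : exists2 C, 0 <= C & forall al X T, al <= 1 -> 0 <= al ->
  fro2 (ubar *m X - xstar) <=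
    C * (fro2 (corrected al X T - xstar) + al ^+ 2 * fro2 T).
Proof.
have q0 := fro2_ge0 q.
exists (2 + 2 * fro2 q); first by rewrite addr_ge0// mulr_ge0.
move=> al X T al1 al0.
have -> : ubar *m X - xstar = (corrected al X T - xstar) + - ((al / n%:R) *: (q *m T)).
  rewrite /corrected; move: (ubar *m X) (_ *: (q *m T)) => y z.
  by apply/rowP => j; rewrite !mxE; ring.
apply: (le_trans (fro2D _ _)); rewrite fro2N fro2Z.
have hn : (al / n%:R) ^+ 2 <= al ^+ 2.
  rewrite exprMn; apply: ler_piMr; first exact: sqr_ge0.
  by rewrite exprn_ile1 ?invr_ge0// invf_le1// ler1n.
have h2 : (al / n%:R) ^+ 2 * fro2 (q *m T) <= al ^+ 2 * (fro2 q * fro2 T).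
  exact: (ler_pM (sqr_ge0 _) (fro2_ge0 _) hn (fro2_mulmx q T)).
have := mulr_ge0 q0 (fro2_ge0 (corrected al X T - xstar)).
have := mulr_ge0 (sqr_ge0 al) (fro2_ge0 T).
lra.
Qed.

(** A crude growth bound, valid for steps of any size, from which finiteness of the second moments
    follows. *)
Lemma fro2_next al X T G : 0 <= al ->
  fro2 (next_X al X T G) + fro2 (next_T T G) <=
    (2 * fro2 A + 4 * al ^+ 2 + 2 * (fro2 B + fro2 (B - 1%:M))) *
    (fro2 X + fro2 T + fro2 G).
Proof.
move=> al0; have hT := fro2_next_T T G.
have hX : fro2 (next_X al X T G) <= 2 * (fro2 A * fro2 X) +
    2 * (al ^+ 2 * (2 * fro2 T + 2 * fro2 G)).
  apply: (le_trans (fro2D _ _)); rewrite fro2N fro2Z; apply: lerD.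
    by apply: ler_wpM2l => //; exact: fro2_mulmx.
  by do 2 (apply: ler_wpM2l; first by rewrite ?sqr_ge0); exact: fro2D.
have x0 := fro2_ge0 X; have t0 := fro2_ge0 T; have g0 := fro2_ge0 G.
have a0 := fro2_ge0 A.
have b0 : 0 <= fro2 B + fro2 (B - 1%:M) by rewrite addr_ge0 ?fro2_ge0.
have := mulr_ge0 a0 t0; have := mulr_ge0 a0 g0.
have := mulr_ge0 b0 x0; have := mulr_ge0 (sqr_ge0 al) x0.
lra.
Qed.

End OneStep.
End Network.

(** * Scalar recursions and step-sizes *)

Section Scalars.
Variable R : realType.

(** The real-number part of the Lyapunov step. Here a, x, t stand for the squared norms of error,
    disagreement and tracker, and qa, qb for the forms dominating x and t. The three smallness
    conditions on al compare the coefficients of a, of qa and of al^2 qb. *)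
Lemma scalar_drift (p th r k1 k2 c2 CG D H al : R) (a x t qa qb : R) :
  0 <= th -> 0 <= k1 -> 0 <= k2 -> 0 <= CG -> 0 <= D -> 0 <= H -> 0 <= c2 ->
  0 < al -> al <= 1 ->
  al * (1 + k2 * (CG * D)) <= p - th ->
  al * (H + k2 * (CG * D) + th) <= 1 - r ->
  al * (H + k2 * (CG * D) + c2 * th) <= c2 * (1 - r) - k1 ->
  0 <= a -> 0 <= x -> 0 <= t -> x <= qa -> t <= qb ->
  (1 + al ^+ 2) * a - al * p * a + r * qa + c2 * al ^+ 2 * (r * qb)
    + k1 * al ^+ 2 * t + k2 * al ^+ 2 * (CG * (1 + D * (a + x + al ^+ 2 * t)))
    + al * (H * (x + al ^+ 2 * t))
  <= (1 - th * al) * (a + qa + c2 * al ^+ 2 * qb) + k2 * CG * al ^+ 2.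
Proof.
move=> th0 k10 k20 CG0 D0 H0 c20 al0 al1 h1 h2 h3 a0 x0 t0 xq tq.
have s0 : 0 <= al ^+ 2 by exact: sqr_ge0.
have s1 : al ^+ 2 <= al by rewrite expr2; apply: ler_piMl => //; exact: ltW.
have q0 : 0 <= qa by exact: le_trans xq.
have qb0 : 0 <= qb by exact: le_trans tq.
have F0 : 0 <= k2 * (CG * D) by rewrite !mulr_ge0.
set F := k2 * (CG * D) in h1 h2 h3 F0.
have -> : k2 * al ^+ 2 * (CG * (1 + D * (a + x + al ^+ 2 * t))) =
    k2 * CG * al ^+ 2 + al ^+ 2 * F * a + al ^+ 2 * F * x + al ^+ 2 * F * (al ^+ 2 * t).
  by rewrite /F; ring.
set s := al ^+ 2 in s0 s1 *.
have aE : s * a + s * F * a <= al * p * a - th * al * a.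
  have := ler_wpM2r a0 (ler_wpM2l (ltW al0) h1); rewrite /s; lra.
have sFx : s * F * x <= al * F * qa.
  by apply: ler_pM => //; [rewrite mulr_ge0|exact: ler_wpM2r].
have sFt : s * F * (s * t) <= al * F * (s * qb).
  apply: ler_pM; [by rewrite mulr_ge0|by rewrite mulr_ge0|exact: ler_wpM2r|exact: ler_wpM2l].
have aHx : al * (H * (x + s * t)) <= al * H * qa + al * H * (s * qb).
  rewrite -mulrDr -mulrA; apply: ler_wpM2l; first exact: ltW.
  apply: ler_wpM2l => //; apply: lerD => //; exact: ler_wpM2l.
have k1t : k1 * s * t <= k1 * (s * qb).
  by rewrite -mulrA; apply: ler_wpM2l => //; exact: ler_wpM2l.
have qaE : al * H * qa + al * F * qa <= qa - r * qa - th * al * qa.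
  have := ler_wpM2r q0 h2; lra.
have qbE : al * H * (s * qb) + al * F * (s * qb) + k1 * (s * qb) <=
    c2 * (s * qb) - c2 * r * (s * qb) - al * c2 * th * (s * qb).
  have := ler_wpM2r (mulr_ge0 s0 qb0) h3; lra.
lra.
Qed.

(** If w_k <= D al_k, the recursion gives w_(k+1) <= D al_k - (th D - C) al_k^2, while D al_(k+1) >=
    D al_k - tau D al_k^2. Induction therefore works once C <= (th - tau) D. *)
Lemma drift_rate (w al : nat -> R) (th tau C : R) K0 :
  tau < th -> 0 <= C ->
  (forall k, (K0 <= k)%N -> [/\ 0 < al k, th * al k <= 1,
     al k - al k.+1 <= tau * al k ^+ 2
     & w k.+1 <= (1 - th * al k) * w k + C * al k ^+ 2]) ->
  exists2 D, 0 < D & forall k, (K0 <= k)%N -> w k <= D * al k.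
Proof.
move=> tauth C0 h.
(* The first summand serves the base case, the second the induction step, and the 1 gives strict
   positivity. *)
pose D := Num.max (w K0 / al K0) 0 + C / (th - tau) + 1.
have d0 : 0 < th - tau by rewrite subr_gt0.
have m0 : 0 <= Num.max (w K0 / al K0) 0 by rewrite le_max lexx orbT.
have CD : C <= (th - tau) * D.
  rewrite -ler_pdivrMl// mulrC /D addrAC lerDr; lra.
have D0 : 0 < D by rewrite /D ltr_wpDl// addr_ge0// divr_ge0// ltW.
exists D => // k /subnK <-; elim: (k - K0)%N => [|m IH].
  rewrite add0n; have [al0 _ _ _] := h K0 (leqnn _).
  rewrite -ler_pdivrMr//.
  apply: (@le_trans _ _ (Num.max (w K0 / al K0) 0)); first by rewrite le_max lexx.
  by rewrite /D -addrA lerDl addr_ge0// divr_ge0// ltW.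
have [al0 al1 dal hw] := h (m + K0)%N (leq_addl _ _).
rewrite addSn; apply: (le_trans hw).
have := ler_wpM2l (_ : 0 <= 1 - th * al (m + K0)%N) IH.
rewrite subr_ge0 => /(_ al1).
have := ler_wpM2l (ltW D0) dal.
have := ler_wpM2r (sqr_ge0 (al (m + K0)%N)) CD.
lra.
Qed.

(** The last clause is the discrete form of -al' <= tau al^2, whose equality case is the harmonic
    decay 1 / (tau k). *)
Definition slowly_vanishing (al : nat -> R) (tau : R) :=
  [/\ forall k, 0 < al k, forall k, al k.+1 <= al k, al @ \oo --> (0 : R)
    & \forall k \near \oo, al k - al k.+1 <= tau * al k ^+ 2].

(** The decrement is of order k^(-1-alpha) and the square of order k^(-2 alpha), so every tau > 0
    works eventually because alpha < 1. *)
Lemma step_power (alpha a b tau : R) : 0 < alpha < 1 -> 0 < a -> 0 < b -> 0 < tau ->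
  slowly_vanishing (fun k : nat => a / (k%:R + b) `^ alpha) tau.
Proof.
move=> /andP[alpha0 alpha1] a0 b0 tau0.
have kb0 k : 0 < k%:R + b :> R by rewrite ltr_wpDl.
have p0 k : 0 < (k%:R + b) `^ alpha by exact: powR_gt0.
have lek k : (k%:R + b) `^ alpha <= (k.+1%:R + b) `^ alpha.
  by rewrite ge0_ler_powR ?nnegrE ?ltW// ltrD2r ltr_nat.
have vanish (be c : R) : 0 < be -> 0 < c -> \forall k \near \oo, 1 <= c * (k%:R + b) `^ be.
  move=> be0 c0; near=> k.
  rewrite -ler_pdivrMl// mulr1.
  have -> : c^-1 = (c^-1 `^ be^-1) `^ be.
    by rewrite -powRrM mulVf ?gt_eqF// powRr1// invr_ge0 ltW.
  rewrite ge0_ler_powR ?nnegrE ?powR_ge0// ?ltW//.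
  apply: (@le_lt_trans _ _ k%:R); last by rewrite ltrDl.
  near: k; exact: nbhs_infty_ger.
split.
- by move=> k; rewrite divr_gt0.
- by move=> k; rewrite ler_pM2l// lef_pV2 ?posrE.
- apply/cvgrPdist_le => e e0.
  have H := vanish alpha (e / a) alpha0 (divr_gt0 e0 a0).
  near=> k.
  have : 1 <= e / a * (k%:R + b) `^ alpha by near: k; exact: H.
  have pk := p0 k.
  rewrite sub0r normrN ger0_norm; last by rewrite divr_ge0// ltW.
  rewrite ler_pdivrMr// -(ler_pM2l a0) mulr1 mulrA [a * (e / a)]mulrC divfK//.
  by rewrite gt_eqF.
- have H := vanish (1 - alpha) (tau * a) (_ : 0 < 1 - alpha) (mulr_gt0 tau0 a0).
  rewrite subr_gt0 in H; have {}H := H alpha1.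
  near=> k.
  have : 1 <= tau * a * (k%:R + b) `^ (1 - alpha) by near: k; exact: H.
  have := lek k; have := p0 k; have := p0 k.+1; have := kb0 k.
  have -> : k.+1%:R + b = (k%:R + b) + 1 by rewrite -natr1 addrAC.
  move: (k%:R + b) => x x0.
  have x10 : 0 < x + 1 by rewrite addr_gt0.
  have r01 : 0 < x / (x + 1) <= 1.
    by rewrite divr_gt0//= ler_pdivrMr// mul1r lerDl.
  (* Replaces a derivative estimate: a base in ]0, 1] increases when raised to a power at most 1.
     With p and p' the powers of x and x + 1, it yields x (p' - p) <= p. *)
  have hr : x / (x + 1) <= (x / (x + 1)) `^ alpha.
    have := ger_powR r01 (ltW alpha1); rewrite powRr1//.
    by rewrite divr_ge0 ?ltW.
  have xE : x `^ alpha = (x / (x + 1)) `^ alpha * (x + 1) `^ alpha.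
    rewrite -powRM ?ltW ?divr_gt0//; congr (_ `^ _).
    by rewrite divfK// gt_eqF.
  have xM : x = x `^ alpha * x `^ (1 - alpha).
    have e : alpha + (1 - alpha) = 1 by ring.
    by rewrite -powRD ?(gt_eqF x0) ?implybT// e powRr1// ltW.
  move: hr xE xM; set r := _ `^ _; set p' := (x + 1) `^ _; set p := x `^ alpha.
  set s := x `^ (1 - alpha) => hr xE xM p'0 p0' pp' h1.
  have hp : x * p' <= (x + 1) * p.
    rewrite xE mulrA; apply: ler_wpM2r; first exact: ltW.
    by rewrite mulrC -ler_pdivrMr.
  have hpx : p <= tau * a * x.
    rewrite xM mulrCA -[leLHS]mulr1; apply: ler_wpM2l => //; exact: ltW.
  rewrite -subr_ge0.
  have -> : tau * (a / p) ^+ 2 - (a / p - a / p') =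
     a / (p ^+ 2 * p') * (tau * a * p' - (p' - p) * p).
    by field; rewrite !gt_eqF.
  apply: mulr_ge0; first by rewrite divr_ge0 ?mulr_ge0 ?exprn_ge0 ?ltW.
  rewrite subr_ge0.
  have d0 : 0 <= p' - p by rewrite subr_ge0.
  apply: (le_trans (ler_wpM2l d0 hpx)).
  have ta : 0 <= tau * a by rewrite mulr_ge0 ?ltW.
  rewrite mulrCA; apply: ler_wpM2l => //; lra.
Unshelve. all: by end_near.
Qed.

Lemma step_harmonic (a b : R) : 0 < a -> 0 < b ->
  slowly_vanishing (fun k : nat => a / (k%:R + b)) a^-1.
Proof.
move=> a0 b0.
have kb0 k : 0 < k%:R + b :> R by rewrite ltr_wpDl.
split.
- by move=> k; rewrite divr_gt0.
- by move=> k; rewrite ler_pM2l// lef_pV2 ?posrE// lerD2r ler_nat.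
- apply/cvgrPdist_le => e e0; near=> k.
  have pk := kb0 k.
  rewrite sub0r normrN ger0_norm; last by rewrite divr_ge0// ltW.
  rewrite ler_pdivrMr// -ler_pdivrMl//.
  apply: (@le_trans _ _ k%:R); last by rewrite lerDl ltW.
  near: k; exact: nbhs_infty_ger.
- near=> k; have := kb0 k.
  have -> : k.+1%:R + b = (k%:R + b) + 1 by rewrite -natr1 addrAC.
  move: (k%:R + b) => x x0; have x10 : 0 < x + 1 by rewrite addr_gt0.
  rewrite -subr_ge0.
  have -> : a^-1 * (a / x) ^+ 2 - (a / x - a / (x + 1)) = a / (x ^+ 2 * (x + 1)).
    by field; rewrite !gt_eqF.
  by rewrite divr_ge0 ?mulr_ge0 ?exprn_ge0 ?ltW.
Unshelve. all: by end_near.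
Qed.

End Scalars.

(** * Independence of the samples *)

Section Independence.
Context d0 (Omega : measurableType d0) (R : realType) (P : probability Omega R).

(** By uniqueness on rectangles, the joint law is the product of the two laws; Tonelli and two
    changes of variables do the rest. *)
Lemma indep_fubini d1 d2 (T1 : measurableType d1) (T2 : measurableType d2)
    (X : Omega -> T1) (Y : Omega -> T2) (F : T1 * T2 -> \bar R) :
  measurable_fun setT X -> measurable_fun setT Y ->
  (forall A B, measurable A -> measurable B ->
     P (X @^-1` A `&` Y @^-1` B) = (P (X @^-1` A) * P (Y @^-1` B))%E) ->
  measurable_fun [set: T1 * T2] F -> (forall t, 0 <= F t)%E ->
  (\int[P]_w F (X w, Y w) = \int[P]_w \int[P]_w' F (X w, Y w'))%E.
Proof.
move=> mX mY ind mF F0.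
pose X' : {mfun Omega >-> T1} := HB.pack X (isMeasurableFun.Build _ _ _ _ X mX).
pose Y' : {mfun Omega >-> T2} := HB.pack Y (isMeasurableFun.Build _ _ _ _ Y mY).
have mXY : measurable_fun setT (fun w => (X w, Y w)).
  exact: measurable_fun_pair.
pose XY : {mfun Omega >-> (T1 * T2)%type} :=
  HB.pack (fun w => (X w, Y w)) (isMeasurableFun.Build _ _ _ _ _ mXY).
pose m1 : probability T1 R := distribution P X'.
pose m2 : probability T2 R := distribution P Y'.
pose m12 : probability _ R := distribution P XY.
have E12 : forall S, measurable S -> (m1 \x m2)%E S = m12 S.
  by apply: product_measure_unique => A B mA mB; rewrite /= -ind.
transitivity (\int[m12]_t F t)%E.
  by rewrite [RHS]ge0_integral_pushforward.
transitivity (\int[(m1 \x m2)%E]_t F t)%E.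
  apply: eq_measure_integral => A mA _. exact: esym (E12 _ mA).
rewrite fubini_tonelli1//.
rewrite [LHS]ge0_integral_pushforward//; last 2 first.
- exact: measurable_fun_fubini_tonelli_F.
- by move=> x _; exact: integral_ge0.
rewrite preimage_setT; apply: eq_integral => w _ /=.
rewrite [LHS]ge0_integral_pushforward//.
by apply: measurableT_comp => //; exact: pair1_measurable.
Qed.

Lemma measurable_inner_integral d1 d2 (T1 : measurableType d1) (T2 : measurableType d2)
    (Y : Omega -> T2) (F : T1 * T2 -> \bar R) :
  measurable_fun setT Y -> measurable_fun [set: T1 * T2] F -> (forall t, 0 <= F t)%E ->
  measurable_fun setT (fun t => \int[P]_w F (t, Y w))%E.
Proof.
move=> mY mF F0.
pose Y' : {mfun Omega >-> T2} := HB.pack Y (isMeasurableFun.Build _ _ _ _ Y mY).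
pose m2 : probability T2 R := distribution P Y'.
rewrite (_ : (fun t => _) = fubini_F m2 F).
  exact: measurable_fun_fubini_tonelli_F.
apply/funext => t; rewrite /fubini_F [RHS]ge0_integral_pushforward//.
by apply: measurableT_comp => //; exact: pair1_measurable.
Qed.

End Independence.

(** * The past of the sampling process and its independence from the next draw *)

Section Histories.
Context (R : realType) (n : nat) (dZ : 'I_n -> measure_display)
  (Z : forall i, measurableType (dZ i)).
Context d0 (Omega : measurableType d0) (P : probability Omega R).

Definition coord_sets : set (set (forall i, Z i)) :=
  [set S | exists i (C : set (Z i)), measurable C /\ S = [set z | C (z i)]].

(** Turns the dependent product into a measurable type whose measurable sets are those of
    [prod_measurable]. *)
Definition sampleT := g_sigma_algebraType coord_sets.

Lemma measurable_coord i : measurable_fun [set: sampleT] (fun z : sampleT => z i).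
Proof.
move=> _ C mC; rewrite setTI; apply: sub_sigma_algebra.
by exists i, C.
Qed.

Lemma measurable_sample d (T : measurableType d) (f : forall i, T -> Z i) :
  (forall i, measurable_fun setT (f i)) ->
  measurable_fun setT (fun t => (fun i => f i t) : sampleT).
Proof.
move=> mf; apply: (@measurability _ _ _ sampleT setT _ coord_sets erefl).
move=> _ [_ [i [C [mC ->]]] <-]; exact: (mf i measurableT C mC).
Qed.

Variable zetas : nat -> forall i, {mfun Omega >-> Z i}.

Definition draw k (w : Omega) : sampleT := fun i => zetas k i w.

Lemma measurable_draw k : measurable_fun setT (draw k).
Proof. by apply: measurable_sample. Qed.

(* Only the samples at times j < k occur. *)
Definition hist_sets k : set (set Omega) :=
  [set E | exists S : nat -> set sampleT, (forall j, measurable (S j)) /\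
    E = \bigcap_(j in [set` iota 0 k]) (draw j @^-1` S j)].

(** The sample space itself with the smaller sigma-algebra of the past. Being determined by the past
    thus becomes measurability on this type, and the random history is the identity map. *)
Definition histT k := g_sigma_algebraType (hist_sets k).

Lemma iota0E k j : [set` iota 0 k] j = (j < k)%N.
Proof. by rewrite /= mem_iota. Qed.

Lemma hist_sets_measurable k : hist_sets k `<=` measurable.
Proof.
move=> _ [S [mS ->]]; apply: bigcap_measurableType => j _.
by rewrite -[X in measurable X]setTI; exact: measurable_draw.
Qed.

Lemma hist_measurable k (E : set (histT k)) :
  measurable E -> measurable (E : set Omega).
Proof. exact: smallest_sub (@sigma_algebra_measurable _ Omega) (@hist_sets_measurable k) E. Qed.

Lemma measurable_to_hist k :
  measurable_fun [set: Omega] (id : Omega -> histT k).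
Proof. by move=> _ E mE; rewrite setTI; exact: (@hist_measurable k E mE). Qed.

Lemma hist_setsI k : setI_closed (hist_sets k).
Proof.
move=> _ _ [S [mS ->]] [S' [mS' ->]].
exists (fun j => S j `&` S' j); split=> [j|]; first exact: measurableI.
apply/seteqP; split=> w /=.
  by move=> [h h'] j jk; split; [exact: h|exact: h'].
by move=> h; split=> j jk; have [] := h j jk.
Qed.

Lemma hist_setsT k : hist_sets k setT.
Proof.
exists (fun=> setT); split=> //.
by rewrite bigcapT // => j _; rewrite preimage_setT.
Qed.

Lemma hist_setsS k : hist_sets k `<=` hist_sets k.+1.
Proof.
move=> _ [S [mS ->]].
exists (fun j => if j == k then setT else S j); split=> [j|]; first by case: (j == k); [exact: measurableT|exact: mS].
apply/seteqP; split=> w h j; rewrite iota0E => jk.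
  case: (eqVneq j k) => // jk'; apply: h.
  by rewrite iota0E ltn_neqAle jk' -ltnS.
have := h j; rewrite iota0E (ltn_trans jk (ltnSn k)) => /(_ isT).
by rewrite (ltn_eqF jk).
Qed.

Lemma measurable_histS k :
  measurable_fun [set: histT k.+1] (id : histT k.+1 -> histT k).
Proof.
move=> _ E mE; rewrite setTI; move: E mE; apply: sub_sigma_algebra2.
exact: hist_setsS.
Qed.

Lemma measurable_hist_draw k :
  measurable_fun [set: histT k.+1] (draw k : histT k.+1 -> sampleT).
Proof.
move=> _ S mS; rewrite setTI; apply: sub_sigma_algebra.
exists (fun j => if j == k then S else setT); split=> [j|]; first by case: (j == k); [exact: mS|exact: measurableT].
apply/seteqP; split=> w.
  by move=> Sw j _; case: eqP => // ->.
by move=> /(_ k); rewrite iota0E ltnSn eqxx; exact.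
Qed.

Hypothesis indep : mutually_independent P (fun k w i => zetas k i w).

(** With S fixed, both sides are finite measures in E. They agree on the cylinders of the past,
    which are stable under intersection, hence on the sigma-algebra generated by them. *)
Lemma hist_draw_indep k (E : set (histT k)) (S : set sampleT) :
  measurable E -> measurable S ->
  P (E `&` draw k @^-1` S) = (P E * P (draw k @^-1` S))%E.
Proof.
move=> mE mS.
have mB : measurable (draw k @^-1` S).
  by rewrite -[X in measurable X]setTI; exact: measurable_draw.
have fB : P (draw k @^-1` S) \is a fin_num by exact: fin_num_measure.
have r0 : 0 <= fine (P (draw k @^-1` S)) by exact: fine_ge0.
pose r := NngNum r0.
have key : forall C, <<s hist_sets k>> C ->
    mrestr P mB C = mscale r P C.
  apply: (@g_sigma_algebra_measure_unique _ R Omega (hist_sets k)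
      (@hist_sets_measurable k) (fun=> setT)).
  - by move=> _; exact: hist_setsT.
  - by apply/seteqP; split=> // w _; exists 0%N.
  - exact: hist_setsI.
  - move=> _ [S' [mS' ->]]; rewrite /= /mrestr /mscale /= fineK//.
    (* One family covering the past and the present, so that mutual independence applies both to the
       times below k and to these times with k added. *)
    pose V j := if j == k then S else S' j.
    have mV j : measurable (V j : set sampleT) by rewrite /V; case: (j == k); [exact: mS|exact: mS'].
    have Vj j : j \in iota 0 k -> V j = S' j.
      by rewrite mem_iota add0n /V => /= jk; rewrite (ltn_eqF jk).
    have uk : uniq (k :: iota 0 k).
      by rewrite /= iota_uniq mem_iota add0n ltnn.
    have /= := indep uk mV.
    have /= := indep (iota_uniq 0 k) mV.
    rewrite big_cons => <-.
    rewrite [X in P X = _ -> _](_ : _ =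
      (\bigcap_(j in [set` iota 0 k]) (draw j @^-1` S' j)) `&` draw k @^-1` S);
      last first.
      apply/seteqP; split=> w /=.
        move=> h; split.
          move=> j jk; have jk' : j \in k :: iota 0 k by rewrite inE [j \in _]jk orbT.
          by have := h j jk'; rewrite Vj.
        by have := h k (mem_head _ _); rewrite /V eqxx.
      move=> [h hS] j jk; have : j \in k :: iota 0 k by exact: jk.
      rewrite inE => /orP[/eqP ->|jk']; first by rewrite /V eqxx.
      by rewrite Vj//; exact: h.
    move=> ->; rewrite {1}/V eqxx; congr (_ * P _)%E.
    by apply: eq_bigcapr => j /= jk; rewrite Vj.
  - move=> _ /=; rewrite /mrestr; apply: (le_lt_trans (probability_le1 P _)).
      by rewrite setTI.
    by rewrite ltry.
by have := key E mE; rewrite /mrestr /mscale /= fineK// muleC.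
Qed.

Lemma hist_fubini k (F : histT k * sampleT -> \bar R) :
  measurable_fun setT F -> (forall t, 0 <= F t)%E ->
  (\int[P]_w F (w, draw k w) = \int[P]_w \int[P]_w' F (w, draw k w'))%E.
Proof.
move=> mF F0.
have ind (A : set (histT k)) (B : set sampleT) : measurable A -> measurable B ->
    P (id @^-1` A `&` draw k @^-1` B) = (P (id @^-1` A) * P (draw k @^-1` B))%E.
  by move=> mA mB; exact: hist_draw_indep.
exact: (indep_fubini (@measurable_to_hist k) (@measurable_draw k) ind mF F0).
Qed.

Lemma hist_fubini_le k (F : histT k * sampleT -> \bar R) (Psi : Omega -> \bar R) :
  measurable_fun setT F -> (forall t, 0 <= F t)%E ->
  measurable_fun setT Psi ->
  (forall w, \int[P]_w' F (w, draw k w') <= Psi w)%E ->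
  (\int[P]_w F (w, draw k w) <= \int[P]_w Psi w)%E.
Proof.
move=> mF F0 mPsi h; rewrite hist_fubini//; apply: ge0_le_integral => //.
- by move=> w _; exact: integral_ge0.
- have mI := measurable_inner_integral P (@measurable_draw k) mF F0.
  exact: (measurableT_comp mI (@measurable_to_hist k)).
Qed.

End Histories.

(** * Functions measurable in one variable and Lipschitz in the other *)

Section Caratheodory.
Context d1 d2 (T1 : measurableType d1) (T2 : measurableType d2) (R : realType).
Variable D : nat.

(** Round x down to the grid of mesh 1 / (m + 1). The rounded map takes countably many values, so
    the composite is measurable on each piece, and the Lipschitz bound makes the composites converge
    pointwise. *)
Lemma measurable_caratheodory (x : T1 -> 'rV[R]_D) (psi : 'rV[R]_D -> T2 -> R)
    (K : T2 -> R) :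
  (forall j, measurable_fun setT (fun t => x t 0 j)) ->
  (forall v, measurable_fun setT (psi v)) ->
  (forall z a b, `|psi a z - psi b z| <= K z * \sum_j `|a 0 j - b 0 j|) ->
  measurable_fun setT (fun t : T1 * T2 => psi (x t.1) t.2).
Proof.
move=> mx mpsi lip.
pose N m t : 'rV[int]_D := \row_j Num.floor (m.+1%:R * x t 0 j).
pose c m (k : 'rV[int]_D) : 'rV[R]_D := \row_j ((k 0 j)%:~R / m.+1%:R).
apply: (@measurable_fun_cvg _ _ R setT (fun m t => psi (c m (N m t.1)) t.2)).
  move=> m _ C mC; rewrite setTI.
  rewrite [X in measurable X](_ : _ =
    \bigcup_(k in [set: 'rV[int]_D])
      ([set t | N m t = k] `*` (psi (c m k) @^-1` C))); last first.
    apply/seteqP; split=> -[t z] /=; first by move=> Cz; exists (N m t).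
    by move=> [k _ [/= -> ]].
  apply: countable_bigcupT_measurable; first exact: countableP.
  move=> k; apply: measurableX.
    rewrite [X in measurable X](_ : _ =
      \bigcap_(j in [set: 'I_D]) ((fun t => m.+1%:R * x t 0 j) @^-1`
        [set` `[(k 0 j)%:~R, (k 0 j + 1)%:~R[ ])); last first.
      apply/seteqP; split=> t /=.
        by move=> <- j _ /=; rewrite mxE in_itv/= floor_itv.
      move=> h; apply/rowP => j; rewrite mxE; apply: floor_def.
      by have := h j I; rewrite /= in_itv.
    apply: fin_bigcap_measurable => // j _.
    rewrite -[X in measurable X]setTI.
    by apply: measurable_funM => //; exact: measurable_itv.
  by rewrite -[X in measurable X]setTI; exact: mpsi.
move=> [t z] _ /=; apply/cvgrPdist_le => e e0.
have KD0 : 0 <= `|K z| * D%:R by rewrite mulr_ge0.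
near=> m.
apply: (@le_trans _ _ (`|K z| * (D%:R * m.+1%:R^-1))).
  apply: (le_trans (lip _ _ _)).
  have S0 : 0 <= \sum_j `|x t 0 j - c m (N m t) 0 j| by apply: sumr_ge0.
  apply: (@le_trans _ _ (`|K z| * \sum_j `|x t 0 j - c m (N m t) 0 j|)).
    by apply: ler_wpM2r => //; exact: ler_norm.
  apply: ler_wpM2l => //.
  rewrite -[D in leRHS]card_ord mulr_natl -sumr_const.
  apply: ler_sum => j _; rewrite !mxE.
  have m0 : 0 < m.+1%:R :> R by [].
  have := floor_itv (m.+1%:R * x t 0 j).
  set f := Num.floor _; rewrite intrD => /andP[h1 h2].
  rewrite -(@ler_pM2l _ m.+1%:R)// -[X in X * `| _ |]gtr0_norm// -normrM.
  rewrite mulrBr mulrCA !divff ?mulr1 ?gt_eqF// ger0_norm ?subr_ge0//.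
  by rewrite lerBlDl ltW.
rewrite mulrA ler_pdivrMr// -ler_pdivrMl//.
apply: (@le_trans _ _ m%:R); last by rewrite ler_nat.
near: m; exact: nbhs_infty_ger.
Unshelve. all: by end_near.
Qed.

End Caratheodory.

(** * Stochastic gradients *)

Section EuclideanFacts.
Variables (R : realType) (d : nat).
Implicit Types x y : 'rV[R]_d.

Lemma dotv_ge0 x : 0 <= dotv x x.
Proof. by apply: sumr_ge0 => j _; rewrite -expr2 sqr_ge0. Qed.

Lemma enorm_ge0 x : 0 <= enorm x.
Proof. exact: sqrtr_ge0. Qed.

Lemma enorm_sqr x : enorm x ^+ 2 = \sum_j x 0 j ^+ 2.
Proof. by rewrite sqr_sqrtr ?dotv_ge0//; apply: eq_bigr => j _; rewrite expr2. Qed.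

Lemma normr_coord_le_enorm x j : `|x 0 j| <= enorm x.
Proof.
rewrite -(@ler_pXn2r _ 2%N)// ?nnegrE ?enorm_ge0// enorm_sqr (bigD1 j)//=.
by rewrite real_normK ?num_real// lerDl; apply: sumr_ge0 => i _; rewrite sqr_ge0.
Qed.

Lemma enorm_le_sum x : enorm x <= \sum_j `|x 0 j|.
Proof.
have S0 : 0 <= \sum_j `|x 0 j| by apply: sumr_ge0.
rewrite -(@ler_pXn2r _ 2%N)// ?nnegrE ?enorm_ge0// enorm_sqr expr2 big_distrl/=.
apply: ler_sum => j _; rewrite -[X in X <= _]real_normK ?num_real// expr2.
apply: ler_wpM2l => //; rewrite (bigD1 j)//= lerDl.
by apply: sumr_ge0.
Qed.

End EuclideanFacts.

Section Integrability.
Context d0 (Omega : measurableType d0) (R : realType) (P : probability Omega R).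
Implicit Types f h : Omega -> R.

Lemma integrable_dominated f h : measurable_fun setT f ->
  (forall w, `|f w| <= h w) -> P.-integrable setT (EFin \o h) ->
  P.-integrable setT (EFin \o f).
Proof.
move=> mf fh ih; apply: (le_integrable measurableT _ _ ih).
  exact/measurable_EFinP.
move=> w _; rewrite /= lee_fin.
by apply: (le_trans (fh w)); exact: ler_norm.
Qed.

Lemma integrable_cst (c : R) : P.-integrable setT (EFin \o (fun=> c)).
Proof. exact: finite_measure_integrable_cst. Qed.

Lemma integrable_add f h : P.-integrable setT (EFin \o f) ->
  P.-integrable setT (EFin \o h) -> P.-integrable setT (EFin \o (fun w => f w + h w)).
Proof.
move=> if_ ih; rewrite (_ : _ \o _ = (EFin \o f) \+ (EFin \o h))%E.
  exact: integrableD.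
by apply/funext => w /=; rewrite EFinD.
Qed.

Lemma integrable_scale c f : P.-integrable setT (EFin \o f) ->
  P.-integrable setT (EFin \o (fun w => c * f w)).
Proof.
move=> if_; rewrite (_ : _ \o _ = (fun w => c%:E * (EFin \o f) w))%E.
  exact: integrableZl.
by apply/funext => w /=; rewrite EFinM.
Qed.

Lemma integrable_ge0 f : measurable_fun setT f -> (forall w, 0 <= f w) ->
  (\int[P]_w (f w)%:E < +oo)%E -> P.-integrable setT (EFin \o f).
Proof.
move=> mf f0 foo; apply/integrableP; split; first exact/measurable_EFinP.
by under eq_integral do rewrite /= ger0_norm//.
Qed.

Lemma sqr_le1powR (p t : R) : 2 <= p -> 0 <= t -> t ^+ 2 <= 1 + t `^ p.
Proof.
move=> p2 t0; have [t1|t1] := leP t 1.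
  apply: (@le_trans _ _ 1); first by rewrite exprn_ile1.
  by rewrite lerDl powR_ge0.
rewrite -powR_mulrn//; apply: (@le_trans _ _ (t `^ p)).
  by rewrite ler_powR// ltW.
by rewrite lerDr.
Qed.

Lemma integrable_sqr_of_powR f p : measurable_fun setT f -> 2 <= p ->
  (forall w, 0 <= f w) -> (\int[P]_w (f w `^ p)%:E < +oo)%E ->
  P.-integrable setT (EFin \o (fun w => f w ^+ 2)).
Proof.
move=> mf p2 f0 foo.
apply: (@integrable_dominated _ (fun w => 1 + f w `^ p)).
- exact: measurable_funX.
- by move=> w; rewrite ger0_norm ?sqr_ge0// sqr_le1powR.
apply: integrable_add; first exact: integrable_cst.
apply: integrable_ge0 => //; last by move=> w; exact: powR_ge0.
by apply: (measurableT_comp (measurable_powR _)).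
Qed.

Lemma integrable_of_sqr f : measurable_fun setT f ->
  P.-integrable setT (EFin \o (fun w => f w ^+ 2)) ->
  P.-integrable setT (EFin \o f).
Proof.
move=> mf if2; apply: (@integrable_dominated _ (fun w => 1 + f w ^+ 2)) => //.
  move=> w; rewrite -[X in 1 + X]real_normK ?num_real//.
  have := normr_ge0 (f w); set t := `|f w| => t0.
  have : 0 <= (t - 1) ^+ 2 by exact: sqr_ge0.
  nra.
by apply: integrable_add => //; exact: integrable_cst.
Qed.

End Integrability.

(** * The sampled gradient of a single agent *)

Section StochasticGradient.
Context d0 (Omega : measurableType d0) (R : realType) (P : probability Omega R).
Context dT (T : measurableType dT) (d : nat).
Variables (zeta : {mfun Omega >-> T}) (g : 'rV[R]_d -> T -> R) (Lip : {mfun T >-> R}).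
Hypothesis mg : forall x, measurable_fun setT (g x).
Hypothesis ig : forall x, P.-integrable setT (EFin \o (fun w => g x (zeta w))).
Hypothesis dg : forall z x, differentiable (g ^~ z) x.
Hypothesis Lip_gt0 : forall z, 0 < Lip z.
Hypothesis lip : forall z x y,
  enorm (grad (g ^~ z) x - grad (g ^~ z) y) <= Lip z * enorm (x - y).
(** The centre c is left free: in the assumption it is the gradient of the local cost, and the
    identification of that gradient with the mean of the sampled one is a result of this section. *)
Hypothesis moments : exists (p : R) (c : 'rV[R]_d -> 'rV[R]_d) (U : 'rV[R]_d -> R),
  [/\ 2 < p, (forall x, 'E_P[fun w => (enorm (grad (g ^~ (zeta w)) x - c x) `^ p)%R]
                 <= (U x)%:E)%E
    & ('E_P[fun w => (Lip (zeta w) `^ p)%R] < +oo)%E].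

Lemma grad_coord_lip z x y j :
  `|grad (g ^~ z) x 0 j - grad (g ^~ z) y 0 j| <= Lip z * \sum_j `|x 0 j - y 0 j|.
Proof.
apply: (@le_trans _ _ (enorm (grad (g ^~ z) x - grad (g ^~ z) y))).
  apply: le_trans (normr_coord_le_enorm _ j).
  by rewrite [X in `|X| <= _](_ : _ = (grad (g ^~ z) x - grad (g ^~ z) y) 0 j) // !mxE.
apply: (le_trans (lip _ _ _)); apply: ler_wpM2l; first exact: ltW.
apply: (le_trans (enorm_le_sum _)).
by apply: ler_sum => i _; rewrite !mxE.
Qed.

(** A partial derivative is the pointwise limit of difference quotients with increments 1 / (m + 1),
    each of them measurable. *)
Lemma measurable_grad x j : measurable_fun setT (fun z => grad (g ^~ z) x 0 j).
Proof.
pose e : 'rV[R]_d := delta_mx 0 j.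
apply: (@measurable_fun_cvg _ _ R setT
  (fun m z => (m.+1%:R : R) * (g (m.+1%:R^-1 *: e + x) z - g x z))).
  move=> m; apply: measurable_funM => //.
  by apply: measurable_funB; exact: mg.
move=> z _; rewrite mxE.
have /cvg_ex[l hl] : derivable (g ^~ z) x e by exact/diff_derivable/dg.
have -> : 'D_e (g ^~ z) x = l by apply: cvg_lim hl; exact: Rhausdorff.
move/cvgr_dnbhsP : hl => /(_ (fun m => m.+1%:R^-1)).
have -> : (fun m => (m.+1%:R : R) * (g (m.+1%:R^-1 *: e + x) z - g x z)) =
  (fun m => (m.+1%:R^-1)^-1 *:
     (((g ^~ z) \o shift x) (m.+1%:R^-1 *: e) - g x z)).
  by apply/funext => m; rewrite invrK.
apply; split; first by move=> m; rewrite invr_neq0.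
exact: cvg_harmonic.
Qed.

Lemma measurable_enorm d1 (S : measurableType d1) (f : S -> 'rV[R]_d) :
  (forall j, measurable_fun setT (fun w => f w 0 j)) ->
  measurable_fun setT (fun w => enorm (f w)).
Proof.
move=> mf; apply: (@measurableT_comp _ _ _ _ _ _ (@Num.sqrt R)).
  by apply: continuous_measurable_fun; exact: sqrt_continuous.
by apply: measurable_sum => j; apply: measurable_funM.
Qed.

Lemma integrable_Lip2 : P.-integrable setT (EFin \o (fun w => Lip (zeta w) ^+ 2)).
Proof.
have [p [_ [_ [p2 _ hL]]]] := moments.
apply: (@integrable_sqr_of_powR _ _ _ _ _ p) => //.
- exact: measurableT_comp.
- exact: ltW.
- by move=> w; exact: ltW.
- by move: hL; rewrite unlock.
Qed.

Lemma integrable_Lip : P.-integrable setT (EFin \o (fun w => Lip (zeta w))).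
Proof.
apply: integrable_of_sqr; first exact: measurableT_comp.
exact: integrable_Lip2.
Qed.

Lemma measurable_grad_zeta x j :
  measurable_fun setT (fun w => grad (g ^~ (zeta w)) x 0 j).
Proof. exact: (measurableT_comp (measurable_grad x j)). Qed.

Lemma integrable_grad2 x j :
  P.-integrable setT (EFin \o (fun w => grad (g ^~ (zeta w)) x 0 j ^+ 2)).
Proof.
have [p [c [U [p2 hU _]]]] := moments.
have me : measurable_fun setT (fun w => enorm (grad (g ^~ (zeta w)) x - c x)).
  apply: measurable_enorm => i.
  under eq_fun do rewrite mxE.
  apply: measurable_funD; first exact: measurable_grad_zeta.
  exact: measurable_cst.
have ie : P.-integrable setT
    (EFin \o (fun w => enorm (grad (g ^~ (zeta w)) x - c x) ^+ 2)).
  apply: (@integrable_sqr_of_powR _ _ _ _ _ p) => //.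
  - exact: ltW.
  - by move=> w; exact: enorm_ge0.
  - by have := hU x; rewrite unlock => /le_lt_trans; apply; exact: ltry.
apply: (@integrable_dominated _ _ _ _ _ (fun w => 2 * (c x 0 j) ^+ 2 +
   2 * enorm (grad (g ^~ (zeta w)) x - c x) ^+ 2)).
- by apply: measurable_funX; exact: measurable_grad_zeta.
- move=> w; rewrite ger0_norm ?sqr_ge0//.
  set v := grad _ x.
  have h : (v 0 j - c x 0 j) ^+ 2 <= enorm (v - c x) ^+ 2.
    rewrite -[X in X <= _]real_normK ?num_real// ler_pXn2r// ?nnegrE ?enorm_ge0//.
    by have := normr_coord_le_enorm (v - c x) j; rewrite !mxE.
  have : 0 <= (v 0 j - 2 * c x 0 j) ^+ 2 by exact: sqr_ge0.
  nra.
apply: integrable_add; first exact: integrable_cst.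
exact: integrable_scale.
Qed.

Lemma integrable_grad x j :
  P.-integrable setT (EFin \o (fun w => grad (g ^~ (zeta w)) x 0 j)).
Proof.
apply: integrable_of_sqr; first exact: measurable_grad_zeta.
exact: integrable_grad2.
Qed.

Definition mean_grad x : 'rV[R]_d :=
  \row_j (\int[P]_w grad (g ^~ (zeta w)) x 0 j)%R.

(** Differentiation under the integral sign along the segment with parameter in ]-1, 1[: there the
    j-th partial derivative is dominated by its absolute value at x plus the Lipschitz variable,
    which is integrable. *)
Lemma is_derive_mean x j :
  is_derive x (delta_mx 0 j) (fun x => fine 'E_P[fun w => g x (zeta w)])%E
    (mean_grad x 0 j).
Proof.
pose e : 'rV[R]_d := delta_mx 0 j.
pose f t w := g (t *: e + x) (zeta w).
have fd t w : (fun h => h^-1 *: ((f^~ w \o shift t) (h *: (1 : R)) - f t w)) =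
   (fun h => h^-1 *: (((g ^~ (zeta w)) \o shift (t *: e + x)) (h *: e) -
                      g (t *: e + x) (zeta w))).
  by apply/funext => h /=; rewrite /f /= scaler1 scalerDl addrA.
have d1f t w : partial1of2 f t w = grad (g ^~ (zeta w)) (t *: e + x) 0 j.
  by rewrite partial1of2E mxE /derive fd.
have /= := @cvg_differentiation_under_integral R _ Omega P f setT measurableT
  0 (-1) 1 _ _ _ (fun w => `|grad (g ^~ (zeta w)) x 0 j| + Lip (zeta w)) _ _ _.
move=> H.
have {H} : h^-1 *: (\int[P]_w f (h + 0) w - \int[P]_w f 0 w) @[h --> 0^'] -->
    \int[P]_w partial1of2 f 0 w.
  apply: H.
  - by rewrite /= in_itv/= ltrN10 ltr01.
  - by move=> t _; exact: ig.
  - move=> t w _ _; rewrite /derivable fd.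
    exact: (diff_derivable (dg (zeta w) (t *: e + x))).
  - by move=> w; rewrite addr_ge0// ltW.
  - apply: integrable_add; last exact: integrable_Lip.
    exact: integrable_norm (integrable_grad x j).
  - move=> t w /=; rewrite in_itv/= => /andP[t1 t2] _; rewrite d1f.
    rewrite -[grad _ (_ + x) 0 j](subrK (grad (g ^~ (zeta w)) x 0 j)) addrC.
    apply: (le_trans (ler_normD _ _)); rewrite lerD2l.
    apply: (le_trans (grad_coord_lip _ _ _ _)).
    rewrite -[leRHS]mulr1; apply: ler_wpM2l; first exact: ltW.
    rewrite (bigD1 j)//= big1 ?addr0 => [|i ij].
      by rewrite !mxE !eqxx /= mulr1 addrK ler_norml !ltW.
    by rewrite !mxE (negbTE ij) andbF mulr0 add0r subrr normr0.
have -> : (fun h => h^-1 *: (\int[P]_w f (h + 0) w - \int[P]_w f 0 w)) =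
  (fun h => h^-1 *: (((fun x => fine 'E_P[fun w => g x (zeta w)]) \o shift x)
     (h *: e) - fine 'E_P[fun w => g x (zeta w)]))%E.
  by apply/funext => h; rewrite /f /= unlock addr0 scale0r add0r.
have -> : \int[P]_w partial1of2 f 0 w = mean_grad x 0 j.
  by rewrite mxE; apply: eq_Rintegral => w _; rewrite d1f scale0r add0r.
move=> H; apply: DeriveDef; first by apply/cvg_ex; exists (mean_grad x 0 j).
by apply: cvg_lim H; exact: Rhausdorff.
Qed.

End StochasticGradient.

(** * Calculus of expectations *)

Section Means.
Context d0 (Omega : measurableType d0) (R : realType) (P : probability Omega R).
Implicit Types (f h : Omega -> R) (m c : R).

(** Integrability and value are kept together, so that sums and multiples of means need no side
    conditions. *)
Definition has_mean f m :=
  P.-integrable setT (EFin \o f) /\ (\int[P]_w (f w)%:E)%E = m%:E.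

Lemma has_mean_cst c : has_mean (fun=> c) c.
Proof.
split; first exact: integrable_cst.
rewrite integral_cst// -[RHS]mule1; congr (_ * _)%E; exact: probability_setT.
Qed.

Lemma has_meanD f h m c : has_mean f m -> has_mean h c ->
  has_mean (fun w => f w + h w) (m + c).
Proof.
move=> [if_ ef] [ih eh]; split; first exact: integrable_add.
under eq_integral do rewrite EFinD.
by rewrite integralD// ef eh.
Qed.

Lemma has_meanZ c f m : has_mean f m -> has_mean (fun w => c * f w) (c * m).
Proof.
move=> [if_ ef]; split; first exact: integrable_scale.
under eq_integral do rewrite EFinM.
by rewrite integralZl// ef.
Qed.

Lemma has_mean_sum (I : Type) (s : seq I) (F : I -> Omega -> R) (M : I -> R) :
  (forall i, has_mean (F i) (M i)) ->
  has_mean (fun w => \sum_(i <- s) F i w) (\sum_(i <- s) M i).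
Proof.
move=> h; elim: s => [|i s IH].
  by rewrite big_nil; under eq_fun do rewrite big_nil; exact: has_mean_cst.
by rewrite big_cons; under eq_fun do rewrite big_cons; exact: has_meanD.
Qed.

Lemma has_mean_le f h m c : (forall w, f w <= h w) ->
  has_mean f m -> has_mean h c -> m <= c.
Proof.
move=> fh [if_ ef] [ih eh]; rewrite -lee_fin -ef -eh.
by apply: le_integral => // w _; rewrite lee_fin.
Qed.

Lemma integrable_has_mean f : P.-integrable setT (EFin \o f) ->
  has_mean f (\int[P]_w f w)%R.
Proof.
by move=> if_; split=> //; rewrite /Rintegral fineK//; exact: integrable_fin_num.
Qed.

Lemma same_law_has_mean dT (T : measurableType dT) (X Y : {mfun Omega >-> T})
    (phi : T -> R) m :
  (forall C, measurable C -> P (X @^-1` C) = P (Y @^-1` C)) ->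
  measurable_fun setT phi -> has_mean (fun w => phi (X w)) m ->
  has_mean (fun w => phi (Y w)) m.
Proof.
move=> XY mphi [iX eX].
have mE : measurable_fun setT (EFin \o phi) by exact/measurable_EFinP.
have iY : P.-integrable setT (EFin \o (fun w => phi (Y w))).
  apply/integrableP; split; first by apply: (measurableT_comp mE).
  move/integrableP : iX => [_]; apply: le_lt_trans.
  have mN : measurable_fun setT (fun t => `|(phi t)%:E|%E).
    exact: measurableT_comp.
  have := @ge0_integral_pushforward _ _ _ _ _ Y (measurable_funPT Y) P setT _
    measurableT mN (fun _ _ => abse_ge0 _).
  have := @ge0_integral_pushforward _ _ _ _ _ X (measurable_funPT X) P setT _
    measurableT mN (fun _ _ => abse_ge0 _).
  rewrite !preimage_setT => hX hY.
  rewrite -[leLHS]hY -[leRHS]hX.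
  by rewrite (eq_measure_integral (pushforward P X))// => A mA _; rewrite /= /pushforward XY.
split=> //; rewrite -eX.
have := @integral_pushforward _ _ _ _ _ Y (measurable_funPT Y) P setT (EFin \o phi) mE iY measurableT.
have := @integral_pushforward _ _ _ _ _ X (measurable_funPT X) P setT (EFin \o phi) mE iX measurableT.
rewrite !preimage_setT => hX hY.
rewrite -[LHS]hY -[RHS]hX.
by rewrite (eq_measure_integral (pushforward P X))// => A mA _; rewrite /= /pushforward XY.
Qed.

End Means.

(** * Moments and mean field of the sampled gradients of all agents *)

Section Oracle.
Variables (R : realType) (n d : nat).
Variables (dZ : 'I_n -> measure_display) (Z : forall i, measurableType (dZ i)).
Variables (dO : measure_display) (Omega : measurableType dO) (P : probability Omega R).
Variables (g : forall i, 'rV[R]_d -> Z i -> R) (zeta : forall i, {mfun Omega >-> Z i}).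
Arguments g : clear implicits.
Variable zetas : nat -> forall i, {mfun Omega >-> Z i}.
Hypothesis zetas_iid : iid_copies P (fun w i => zeta i w) (fun k w i => zetas k i w).
Hypothesis g_costs : finite_costs P g zeta.
Variable xstar : 'rV[R]_d.
Hypothesis xstar_opt : forall x, cost P g zeta xstar <= cost P g zeta x.
Variables (Lip : forall i, {mfun Z i >-> R}) (mu : R).
Hypothesis asm1 : objective_assumption P g zeta Lip mu xstar.
Implicit Types X Y : 'M[R]_(n, d).

Definition gradmx X (z : forall i, Z i) : 'M[R]_(n, d) :=
  \matrix_(i, j) grad (g i ^~ (z i)) (row i X) 0 j.

Definition meanmx X : 'M[R]_(n, d) :=
  \matrix_(i, j) mean_grad P (zeta i) (g i) (row i X) 0 j.

Let mg i x : measurable_fun setT (g i x). Proof. by case: (g_costs i x). Qed.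

Let ig i x : P.-integrable setT (EFin \o (fun w => g i x (zeta i w))).
Proof. by case: (g_costs i x). Qed.

Let dg i z x : differentiable (g i ^~ z) x.
Proof. exact: obj_sample_differentiable asm1 _ _ _. Qed.

Let Lip_gt0 i z : 0 < Lip i z.
Proof. exact: obj_lipschitz_gt0 asm1 _ _. Qed.

Let lip i z x y :
  enorm (grad (g i ^~ z) x - grad (g i ^~ z) y) <= Lip i z * enorm (x - y).
Proof. exact: obj_lipschitz asm1 _ _ _ _. Qed.

Let moments i : exists (p : R) (c : 'rV[R]_d -> 'rV[R]_d) (U : 'rV[R]_d -> R),
  [/\ 2 < p, (forall x, 'E_P[fun w => (enorm (grad (g i ^~ (zeta i w)) x - c x) `^ p)%R]
                 <= (U x)%:E)%E
    & ('E_P[fun w => (Lip i (zeta i w) `^ p)%R] < +oo)%E].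
Proof.
have [p [U [p2 _ hU hL]]] := obj_moments asm1 i.
by exists p, (grad (local_cost P g zeta i)), (fun=> U `^ (p / 2)).
Qed.

Lemma zetas_law k i (C : set (Z i)) : measurable C ->
  P (zeta i @^-1` C) = P (zetas k i @^-1` C).
Proof.
move=> mC; have [_ /(_ k) h] := zetas_iid.
have := h [set z | C (z i)]; move=> /(_ _)/esym; apply.
by apply: sub_sigma_algebra; exists i, C.
Qed.

Lemma meanmxE X i j : meanmx X i j =
  (\int[P]_w grad (g i ^~ (zeta i w)) (row i X) 0 j)%R.
Proof. by rewrite mxE [LHS]mxE. Qed.

Lemma gradmx_mean k X i j :
  has_mean P (fun w => gradmx X (fun i => zetas k i w) i j) (meanmx X i j).
Proof.
under eq_fun do rewrite mxE.
apply: (@same_law_has_mean _ _ _ _ _ _ (zeta i) (zetas k i)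
  (fun z => grad (g i ^~ z) (row i X) 0 j)).
- exact: zetas_law.
- exact: measurable_grad.
- rewrite meanmxE; apply: integrable_has_mean.
  exact: (integrable_grad (@mg i) (@dg i) (@moments i)).
Qed.

(** The value s is shared by the draw at time k and the reference variable, so bounds computed for
    the latter hold uniformly in k. *)
Lemma gradmx_sqr_mean k i j X : exists2 s,
  has_mean P (fun w => gradmx X (fun i => zetas k i w) i j ^+ 2) s &
  has_mean P (fun w => grad (g i ^~ (zeta i w)) (row i X) 0 j ^+ 2) s.
Proof.
have h := integrable_has_mean
  (integrable_grad2 (@mg i) (@dg i) (@moments i) (row i X) j).
exists (\int[P]_w grad (g i ^~ (zeta i w)) (row i X) 0 j ^+ 2)%R => //.
under eq_fun do rewrite mxE.
apply: (@same_law_has_mean _ _ _ _ _ _ (zeta i) (zetas k i)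
  (fun z => grad (g i ^~ z) (row i X) 0 j ^+ 2)) => //.
- exact: zetas_law.
- by apply: measurable_funX; exact: measurable_grad.
Qed.

Lemma sqr_sum_norm_le (a : 'I_d -> R) :
  (\sum_l `|a l|) ^+ 2 <= d%:R * \sum_l a l ^+ 2.
Proof.
have := sumr_sqr_le (fun l : 'I_d => 1) (fun l => `|a l|).
under eq_bigr do rewrite mul1r.
under [X in _ <= X * _]eq_bigr do rewrite expr1n.
rewrite sumr_const card_ord => /le_trans; apply.
apply: ler_wpM2l => //; apply: ler_sum => l _.
by rewrite real_normK ?num_real.
Qed.

Lemma grad_coord_sqr_le i (z : Z i) (x y : 'rV[R]_d) j : grad (g i ^~ z) x 0 j ^+ 2 <=
  2 * d%:R * (\sum_l (x 0 l - y 0 l) ^+ 2) * Lip i z ^+ 2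
  + 2 * grad (g i ^~ z) y 0 j ^+ 2.
Proof.
have h := grad_coord_lip (@Lip_gt0 i) (@lip i) z x y j.
set a := grad _ x 0 j in h *; set b := grad _ y 0 j in h *.
have S0 : 0 <= \sum_l `|x 0 l - y 0 l| by exact: sumr_ge0.
have h2 : (a - b) ^+ 2 <= Lip i z ^+ 2 * (d%:R * \sum_l (x 0 l - y 0 l) ^+ 2).
  rewrite -real_normK ?num_real//.
  apply: (@le_trans _ _ ((Lip i z * \sum_l `|x 0 l - y 0 l|) ^+ 2)).
    by rewrite ler_pXn2r ?nnegrE// mulr_ge0// ltW.
  rewrite exprMn; apply: ler_wpM2l; first exact: sqr_ge0.
  exact: sqr_sum_norm_le.
have := sqr_ge0 (a - 2 * b).
move: h2; move: (\sum_l _) (Lip i z ^+ 2) => s L h2 h3.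
nra.
Qed.

(** Each sampled gradient is compared with the one at [xstar] through its random Lipschitz constant;
    the constant CG is built from the second moments of these two quantities. *)
Lemma gradmx_second_moment : exists2 CG, 0 <= CG & forall k X, exists2 s,
  has_mean P (fun w => fro2 (gradmx X (fun i => zetas k i w))) s &
  s <= CG * (1 + fro2 (X - const_mx 1 *m xstar)).
Proof.
pose lam i := (\int[P]_w Lip i (zeta i w) ^+ 2)%R.
have hlam i : has_mean P (fun w => Lip i (zeta i w) ^+ 2) (lam i).
  exact/integrable_has_mean/(integrable_Lip2 (@Lip_gt0 i) (@moments i)).
pose kap i j := (\int[P]_w grad (g i ^~ (zeta i w)) xstar 0 j ^+ 2)%R.
have hkap i j : has_mean P (fun w => grad (g i ^~ (zeta i w)) xstar 0 j ^+ 2) (kap i j).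
  exact/integrable_has_mean/(integrable_grad2 (@mg i) (@dg i) (@moments i)).
have lam0 i : 0 <= lam i by apply: Rintegral_ge0 => w _; exact: sqr_ge0.
have kap0 i j : 0 <= kap i j by apply: Rintegral_ge0 => w _; exact: sqr_ge0.
pose L := 2 * d%:R * d%:R * \sum_i lam i.
have L0 : 0 <= L by rewrite !mulr_ge0//; exact: sumr_ge0.
pose K := \sum_i \sum_j 2 * kap i j.
have K0 : 0 <= K.
  by apply: sumr_ge0 => i _; apply: sumr_ge0 => j _; rewrite mulr_ge0.
exists (L + K); first exact: addr_ge0.
move=> k X.
pose s i j : R := s2val (cid2 (gradmx_sqr_mean k i j X)).
have hs i j : has_mean P (fun w => gradmx X (fun i => zetas k i w) i j ^+ 2) (s i j).
  exact: s2valP (cid2 (gradmx_sqr_mean k i j X)).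
have hs' i j : has_mean P (fun w => grad (g i ^~ (zeta i w)) (row i X) 0 j ^+ 2) (s i j).
  exact: s2valP' (cid2 (gradmx_sqr_mean k i j X)).
exists (\sum_i \sum_j s i j).
  by apply: has_mean_sum => i; apply: has_mean_sum => j; exact: hs.
set D := X - _.
have DE i l : row i X 0 l - xstar 0 l = D i l.
  by rewrite /D !mxE big_ord1 mxE mul1r.
have sle i j : s i j <= 2 * d%:R * (\sum_l D i l ^+ 2) * lam i + 2 * kap i j.
  apply: (has_mean_le _ (hs' i j) (has_meanD (has_meanZ _ (hlam i)) (has_meanZ _ (hkap i j)))).
  move=> w; have := grad_coord_sqr_le (zeta i w) (row i X) xstar j.
  by under eq_bigr do rewrite DE.
apply: (@le_trans _ _ (L * fro2 D + K)).
  rewrite /K; apply: (@le_trans _ _ (\sum_i ((\sum_l D i l ^+ 2) * L + \sum_j 2 * kap i j))).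
    apply: ler_sum => i _.
    apply: (le_trans (ler_sum _ (fun j _ => sle i j))).
    rewrite big_split /= lerD2r sumr_const card_ord -mulr_natr.
    have Di : 0 <= \sum_l D i l ^+ 2 by apply: sumr_ge0 => l _; exact: sqr_ge0.
    have li : lam i <= \sum_i lam i by rewrite (bigD1 i)//= lerDl; exact: sumr_ge0.
    have c0 : 0 <= 2 * d%:R * d%:R * \sum_l D i l ^+ 2 :> R by rewrite !mulr_ge0.
    have := ler_wpM2l c0 li; rewrite /L; lra.
  by rewrite big_split /= -mulr_suml lerD2r mulrC.
rewrite mulrDl !mulrDr !mulr1.
have := mulr_ge0 K0 (fro2_ge0 D); lra.
Qed.

Lemma mx_subE X Y i j : (X - Y) i j = X i j - Y i j.
Proof. by rewrite !mxE. Qed.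

Lemma meanmx_coord_lip : exists2 ell : 'I_n -> R, forall i, 0 <= ell i &
  forall X Y i j, `|meanmx X i j - meanmx Y i j| <= (\sum_l `|(X - Y) i l|) * ell i.
Proof.
pose ell i := (\int[P]_w Lip i (zeta i w))%R.
have hell i : has_mean P (fun w => Lip i (zeta i w)) (ell i).
  exact/integrable_has_mean/(integrable_Lip (@Lip_gt0 i) (@moments i)).
exists ell; first by move=> i; apply: Rintegral_ge0 => w _; exact: ltW.
move=> X Y i j; set s := \sum_l _.
have hm (W : 'M[R]_(n, d)) : has_mean P
    (fun w => grad (g i ^~ (zeta i w)) (row i W) 0 j) (meanmx W i j).
  rewrite meanmxE.
  exact/integrable_has_mean/(integrable_grad (@mg i) (@dg i) (@moments i)).
have [hX hY] := (hm X, hm Y); have hl := has_meanZ s (hell i).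
have sE : s = \sum_l `|row i X 0 l - row i Y 0 l|.
  by apply: eq_bigr => l _; rewrite mx_subE !mxE.
have key w := grad_coord_lip (@Lip_gt0 i) (@lip i) (zeta i w) (row i X) (row i Y) j.
have {}key w : - (s * Lip i (zeta i w)) <=
    grad (g i ^~ (zeta i w)) (row i X) 0 j - grad (g i ^~ (zeta i w)) (row i Y) 0 j
    <= s * Lip i (zeta i w).
  by rewrite -ler_norml mulrC sE; exact: key.
have ub : meanmx X i j <= s * ell i + meanmx Y i j.
  apply: (has_mean_le _ hX (has_meanD hl hY)) => w.
  by have /andP[_] := key w; rewrite lerBlDr.
have lb : meanmx Y i j <= s * ell i + meanmx X i j.
  apply: (has_mean_le _ hY (has_meanD hl hX)) => w.
  by have /andP[+ _] := key w; rewrite lerBrDr addrC lerBlDr addrC.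
by rewrite ler_norml lerBlDr ub andbT lerBrDr addrC lerBlDr addrC.
Qed.

Lemma meanmx_lip : exists2 C, 0 <= C & forall X Y,
  fro2 (meanmx X - meanmx Y) <= C * fro2 (X - Y).
Proof.
have [ell ell0 hell] := meanmx_coord_lip.
pose L := \sum_i ell i ^+ 2.
have L0 : 0 <= L by apply: sumr_ge0 => i _; exact: sqr_ge0.
exists (d%:R * d%:R * L); first by rewrite !mulr_ge0.
move=> X Y; move: (meanmx X) (meanmx Y) (hell X Y) => MX MY {hell}.
move: (X - Y) => D hD; rewrite /fro2 mulr_sumr; apply: ler_sum => i _.
set S := \sum_j D i j ^+ 2.
have S0 : 0 <= S by apply: sumr_ge0 => l _; exact: sqr_ge0.
apply: (@le_trans _ _ (\sum_(j < d) (ell i ^+ 2 * (d%:R * S)))); last first.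
  rewrite sumr_const card_ord -[_ *+ d]mulr_natr.
  have li : ell i ^+ 2 <= L.
    by rewrite /L (bigD1 i)//= lerDl; apply: sumr_ge0 => k _; exact: sqr_ge0.
  have c0 : 0 <= d%:R * d%:R * S by rewrite !mulr_ge0.
  have := ler_wpM2l c0 li; lra.
apply: ler_sum => j _; rewrite mx_subE.
apply: (@le_trans _ _ (((\sum_l `|D i l|) * ell i) ^+ 2)).
  move: (hD i j); move: (_ - _) (_ * _) => y r yr.
  rewrite -real_normK ?num_real// lerXn2r// nnegrE.
  exact: le_trans yr.
by rewrite exprMn mulrC; apply: ler_wpM2l; [exact: sqr_ge0|exact: sqr_sum_norm_le].
Qed.

Lemma grad_cost x : grad (cost P g zeta) x = \sum_i mean_grad P (zeta i) (g i) x.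
Proof.
apply/rowP => j; rewrite mxE summxE.
have h i := is_derive_mean (@mg i) (@ig i) (@dg i) (@Lip_gt0 i) (@lip i) (@moments i) x j.
rewrite (_ : cost P g zeta = \sum_i local_cost P g zeta i); last first.
  by apply/funext => y; rewrite fct_sumE.
rewrite derive_sum; last by move=> i; case: (h i).
by apply: eq_bigr => i _; case: (h i).
Qed.

(** At consensus the column sums of the mean field are the gradient of the global cost, the only
    place where convexity is available. *)
Lemma sum_meanmx_const (z : 'rV[R]_d) :
  const_mx 1 *m meanmx (const_mx 1 *m z) = grad (cost P g zeta) z.
Proof.
have rE i : row i (const_mx 1 *m z) = z.
  by apply/rowP => l; rewrite !mxE big_ord1 mxE mul1r.
rewrite grad_cost; apply/rowP => j; rewrite [LHS]mxE [RHS]summxE.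
by apply: eq_bigr => i _; rewrite [const_mx 1 _ _]mxE mul1r [LHS]mxE rE.
Qed.

(* Optimality of [xstar] in the form f(x* ) <= f(z) costs a factor 2 compared with
   strong monotonicity of the gradient; the strict bound on [a] leaves room for it. *)
Lemma grad_cost_monotone (z : 'rV[R]_d) :
  mu / 2 * fro2 (z - xstar) <= dotv (z - xstar) (grad (cost P g zeta) z).
Proof.
have := obj_strongly_convex asm1 z xstar; have := xstar_opt z.
rewrite enorm_fro2.
have -> : dotv (grad (cost P g zeta) z) (xstar - z) =
    - dotv (z - xstar) (grad (cost P g zeta) z).
  rewrite -sumrN; apply: eq_bigr => j _; rewrite [(xstar - z) 0 j]mxE.
  rewrite [(z - xstar) 0 j]mxE [(- z) 0 j]mxE [(- xstar) 0 j]mxE; ring.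
lra.
Qed.

(** The mean field at X is compared with that at the consensus point z; it is Lipschitz, and Young's
    inequality pays for the difference with an arbitrarily small part h of the strong convexity. *)
Lemma descent_direction h : 0 < h -> exists2 C, 0 <= C & forall X (z : 'rV[R]_d),
  (mu - h) * fro2 (z - xstar) - C * fro2 (X - const_mx 1 *m z) <=
  2 * dotv (z - xstar) (const_mx 1 *m meanmx X).
Proof.
move=> h0; have [C0 C00 hC] := meanmx_lip.
pose c := fro2 (const_mx 1 : 'rV[R]_n).
have c0 : 0 <= c by exact: fro2_ge0.
exists (h^-1 * (c * C0)); first by rewrite !mulr_ge0// invr_ge0 ltW.
move=> X z; have e := sum_meanmx_const z.
have h2 := grad_cost_monotone z; have hD := hC (const_mx 1 *m z) X.
move: (meanmx _) (meanmx X) (grad _ z) e h2 hD => M N G e h2 hD.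
have -> : (const_mx 1 : 'rV_n) *m N = G + (-1) *: (const_mx 1 *m (M - N)).
  by rewrite mulmxBr e scaleN1r opprB addrC subrK.
have h1 : fro2 ((const_mx 1 : 'rV_n) *m (M - N)) <= c * (C0 * fro2 (X - const_mx 1 *m z)).
  apply: (le_trans (fro2_mulmx _ (M - N)) (ler_wpM2l c0 _)).
  by rewrite -[fro2 (X - _)]fro2N opprB.
rewrite dotvDr dotvZr.
have h3 := dotv_young (z - xstar) ((const_mx 1 : 'rV_n) *m (M - N)) h0.
have hi : 0 <= h^-1 by rewrite invr_ge0 ltW.
have h4 := ler_wpM2l hi h1.
lra.
Qed.

End Oracle.

(** * The iteration as a Markov chain *)

Section MatrixMeasurability.
Context dS (S : measurableType dS) (R : realType).

Definition mx_measurable m p (f : S -> 'M[R]_(m, p)) :=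
  forall i j, measurable_fun setT (fun s => f s i j).

Lemma mx_measurable_cst m p (M : 'M[R]_(m, p)) : mx_measurable (fun=> M).
Proof. by move=> i j; exact: measurable_cst. Qed.

Lemma mx_measurableD m p (f h : S -> 'M[R]_(m, p)) :
  mx_measurable f -> mx_measurable h -> mx_measurable (fun s => f s + h s).
Proof.
move=> mf mh i j; under eq_fun do rewrite mxE.
by apply: measurable_funD; [exact: mf|exact: mh].
Qed.

Lemma mx_measurableZ m p c (f : S -> 'M[R]_(m, p)) :
  mx_measurable f -> mx_measurable (fun s => c *: f s).
Proof.
move=> mf i j; under eq_fun do rewrite mxE.
by apply: measurable_funM; [exact: measurable_cst|exact: mf].
Qed.

Lemma mx_measurableB m p (f h : S -> 'M[R]_(m, p)) :
  mx_measurable f -> mx_measurable h -> mx_measurable (fun s => f s - h s).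
Proof.
move=> mf mh; under eq_fun do rewrite -scaleN1r.
by apply: mx_measurableD => //; exact: mx_measurableZ.
Qed.

Lemma mx_measurable_mulmx m n p (M : 'M[R]_(m, n)) (f : S -> 'M[R]_(n, p)) :
  mx_measurable f -> mx_measurable (fun s => M *m f s).
Proof.
move=> mf i j; under eq_fun do rewrite mxE.
apply: measurable_sum => k; apply: measurable_funM; [exact: measurable_cst|exact: mf].
Qed.

Lemma measurable_fro2 m p (f : S -> 'M[R]_(m, p)) :
  mx_measurable f -> measurable_fun setT (fun s => fro2 (f s)).
Proof.
move=> mf; apply: measurable_sum => i; apply: measurable_sum => j.
by apply: measurable_funX; exact: mf.
Qed.

End MatrixMeasurability.

Section Process.
Variables (R : realType) (n d : nat).
Variables (dZ : 'I_n -> measure_display) (Z : forall i, measurableType (dZ i)).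
Variables (dO : measure_display) (Omega : measurableType dO) (P : probability Omega R).
Variables (g : forall i, 'rV[R]_d -> Z i -> R) (zeta : forall i, {mfun Omega >-> Z i}).
Arguments g : clear implicits.
Variable zetas : nat -> forall i, {mfun Omega >-> Z i}.
Hypothesis zetas_iid : iid_copies P (fun w i => zeta i w) (fun k w i => zetas k i w).
Hypothesis g_costs : finite_costs P g zeta.
Variables (xstar : 'rV[R]_d) (Lip : forall i, {mfun Z i >-> R}) (mu : R).
Hypothesis asm1 : objective_assumption P g zeta Lip mu xstar.
Variables (A B : 'M[R]_n) (al : nat -> R) (x0 : 'I_n -> 'rV[R]_d).

(** The second component starts at 0 because y_0 is the sampled gradient at time 0. *)
Fixpoint state k (w : Omega) : 'M[R]_(n, d) * 'M[R]_(n, d) :=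
  match k with
  | 0%N => (\matrix_(i, j) x0 i 0 j, 0)
  | m.+1 =>
      let: (X, T) := state m w in
      let G := gradmx g X (draw zetas m w) in (next_X A (al m) X T G, next_T B T G)
  end.

Lemma state_S k w : state k.+1 w =
  let: G := gradmx g (state k w).1 (draw zetas k w) in
  (next_X A (al k) (state k w).1 (state k w).2 G, next_T B (state k w).2 G).
Proof. by rewrite /=; case: (state k w). Qed.

Lemma row_gradmx X (z : forall i, Z i) i : row i (gradmx g X z) = grad (g i ^~ (z i)) (row i X).
Proof. by apply/rowP => j; rewrite [LHS]mxE [LHS]mxE. Qed.

Lemma row_mulmx_sum (M : 'M[R]_n) (X : 'M[R]_(n, d)) i :
  row i (M *m X) = \sum_j M i j *: row j X.
Proof.
apply/rowP => l; rewrite !mxE summxE; apply: eq_bigr => j _.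
by rewrite !mxE.
Qed.

Lemma sab_state k w : sab g A B al x0 (fun m i => zetas m i w) k =
  (fun i => row i (state k w).1,
   fun i => row i ((state k w).2 + gradmx g (state k w).1 (draw zetas k w))).
Proof.
elim: k => [|k IH].
  have x0E i : row i (\matrix_(i, j) x0 i 0 j : 'M[R]_(n, d)) = x0 i.
    by apply/rowP => j; rewrite !mxE.
  rewrite /=; congr pair; apply/funext => i; first by rewrite x0E.
  by rewrite add0r row_gradmx x0E.
rewrite [LHS]/= IH state_S /=.
set X := (state k w).1; set T := (state k w).2.
set G := gradmx g X _.
have xE i : \sum_(j < n) A i j *: row j X - al k *: row i (T + G) =
    row i (next_X A (al k) X T G).
  by rewrite /next_X linearB /= [row i (_ *: _)]linearZ /= row_mulmx_sum.
have rowD' (M N : 'M[R]_(n, d)) i : row i (M + N) = row i M + row i N by rewrite linearD.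
have rowN' (M : 'M[R]_(n, d)) i : row i (- M) = - row i M by rewrite linearN.
congr pair; apply/funext => i; first exact: xE.
rewrite (rowD' (next_T B T G)) row_gradmx -xE.
rewrite [row i (next_T _ _ _)](rowD' (B *m (T + G)) (- G)) rowN' row_mulmx_sum.
by rewrite [row i G]row_gradmx addrAC.
Qed.

(** Column stochasticity makes the column sums of B (T + G) equal to those of T + G, so subtracting
    G restores the column sums of T. *)
Lemma state_sum0 k w : const_mx 1 *m B = const_mx 1 :> 'rV_n ->
  const_mx 1 *m (state k w).2 = 0 :> 'rV_d.
Proof.
move=> B1; elim: k => [|k IH]; first by rewrite mulmx0.
rewrite state_S /= /next_T mulmxBr mulmxA B1 mulmxDr IH add0r.
by rewrite subrr.
Qed.

Let Lip_gt0 i z : 0 < Lip i z.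
Proof. exact: obj_lipschitz_gt0 asm1 _ _. Qed.

Let lip i z x y :
  enorm (grad (g i ^~ z) x - grad (g i ^~ z) y) <= Lip i z * enorm (x - y).
Proof. exact: obj_lipschitz asm1 _ _ _ _. Qed.

(** Joint measurability in state and sample: the gradient is measurable in the sample and Lipschitz
    in the point. *)
Lemma gradmx_measurable dS (S : measurableType dS) (X : S -> 'M[R]_(n, d)) :
  mx_measurable X ->
  mx_measurable (fun t : S * sampleT Z => gradmx g (X t.1) t.2).
Proof.
move=> mX i j.
have -> : (fun t : S * sampleT Z => gradmx g (X t.1) t.2 i j) =
    (fun t => grad (g i ^~ (t.2 i)) (row i (X t.1)) 0 j).
  by apply/funext => t; rewrite mxE.
apply: (@measurable_caratheodory _ _ S (sampleT Z) R d (fun s => row i (X s))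
  (fun v (z : sampleT Z) => grad (g i ^~ (z i)) v 0 j) (fun z => Lip i (z i))).
- by move=> l; under eq_fun do rewrite mxE; exact: mX.
- move=> v; apply: (@measurableT_comp _ _ _ _ _ _ (fun z => grad (g i ^~ z) v 0 j)).
    apply: measurable_grad => [x|z x]; first by case: (g_costs i x).
    exact: obj_sample_differentiable asm1 _ _ _.
  exact: measurable_coord.
- by move=> z a b; exact: grad_coord_lip (@Lip_gt0 i) (@lip i) _ _ _ _.
Qed.

Lemma mx_measurable_comp dS dS' (S : measurableType dS) (S' : measurableType dS') m p
    (f : S' -> 'M[R]_(m, p)) (h : S -> S') :
  mx_measurable f -> measurable_fun setT h -> mx_measurable (fun s => f (h s)).
Proof. by move=> mf mh i j; exact: (measurableT_comp (mf i j) mh). Qed.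

Lemma next_X_measurable dS (S : measurableType dS) c (X T G : S -> 'M[R]_(n, d)) :
  mx_measurable X -> mx_measurable T -> mx_measurable G ->
  mx_measurable (fun s => next_X A c (X s) (T s) (G s)).
Proof.
move=> mX mT mG; apply: mx_measurableB; first exact: mx_measurable_mulmx.
by apply: mx_measurableZ; exact: mx_measurableD.
Qed.

Lemma next_T_measurable dS (S : measurableType dS) (T G : S -> 'M[R]_(n, d)) :
  mx_measurable T -> mx_measurable G ->
  mx_measurable (fun s => next_T B (T s) (G s)).
Proof.
move=> mT mG; apply: mx_measurableB => //; apply: mx_measurable_mulmx.
exact: mx_measurableD.
Qed.

Section Transition.
Variable k : nat.
Hypothesis mX : mx_measurable (fun w : histT zetas k => (state k w).1).
Hypothesis mT : mx_measurable (fun w : histT zetas k => (state k w).2).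

Definition transition (t : histT zetas k * sampleT Z) : 'M[R]_(n, d) * 'M[R]_(n, d) :=
  let: G := gradmx g (state k t.1).1 t.2 in
  (next_X A (al k) (state k t.1).1 (state k t.1).2 G, next_T B (state k t.1).2 G).

Lemma transition_measurable :
  mx_measurable (fun t => (transition t).1) /\ mx_measurable (fun t => (transition t).2).
Proof.
have mG := gradmx_measurable mX.
have mX' := mx_measurable_comp mX (@measurable_fst _ _ (histT zetas k) (sampleT Z)).
have mT' := mx_measurable_comp mT (@measurable_fst _ _ (histT zetas k) (sampleT Z)).
split; first exact: (next_X_measurable _ mX' mT' mG).
exact: (next_T_measurable mT' mG).
Qed.

End Transition.

Lemma state_hist_measurable k :
  mx_measurable (fun w : histT zetas k => (state k w).1) /\
  mx_measurable (fun w : histT zetas k => (state k w).2).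
Proof.
elim: k => [|k [mX mT]]; first by split; exact: mx_measurable_cst.
have [m1 m2] := transition_measurable mX mT.
have mp : measurable_fun [set: histT zetas k.+1]
    (fun w : histT zetas k.+1 => ((w, draw zetas k w) : histT zetas k * sampleT Z)).
  apply: measurable_fun_pair; first exact: (@measurable_histS _ _ _ _ _ zetas k).
  exact: (@measurable_hist_draw _ _ _ _ _ zetas k).
split.
  have := mx_measurable_comp m1 mp.
  by congr mx_measurable; apply/funext => w; rewrite state_S.
have := mx_measurable_comp m2 mp.
by congr mx_measurable; apply/funext => w; rewrite state_S.
Qed.

Lemma state_measurable k : mx_measurable (fun w => (state k w).1) /\
  mx_measurable (fun w => (state k w).2).
Proof.
have [mX mT] := state_hist_measurable k.
have mid := @measurable_to_hist _ _ _ _ _ zetas k.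
by split; [exact: (mx_measurable_comp mX mid)|exact: (mx_measurable_comp mT mid)].
Qed.

(** Measurability is tested by composition with entrywise measurable maps, so no sigma-algebra on
    pairs of matrices is involved; the same property serves on the history, on its product with the
    samples and on the whole space. *)
Definition borel2 (Phi : 'M[R]_(n, d) -> 'M[R]_(n, d) -> R) :=
  forall dS (S : measurableType dS) (X T : S -> 'M[R]_(n, d)),
  mx_measurable X -> mx_measurable T -> measurable_fun setT (fun s => Phi (X s) (T s)).

Definition state_mean (Phi : 'M[R]_(n, d) -> 'M[R]_(n, d) -> R) k : \bar R :=
  (\int[P]_w (Phi (state k w).1 (state k w).2)%:E)%E.

Lemma measurable_state_fun Phi k : borel2 Phi ->
  measurable_fun setT (fun w => Phi (state k w).1 (state k w).2).
Proof. by move=> mPhi; have [mX mT] := state_measurable k; exact: mPhi. Qed.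

(* The state at time k is independent of the sample drawn at time k, so a drift
   inequality only has to be checked from deterministic states. *)
Lemma state_mean_step (Phi Psi : 'M[R]_(n, d) -> 'M[R]_(n, d) -> R) k :
  const_mx 1 *m B = const_mx 1 :> 'rV_n ->
  borel2 Phi -> borel2 Psi -> (forall X T, 0 <= Phi X T) ->
  (forall X T, const_mx 1 *m T = 0 :> 'rV_d ->
    (\int[P]_w (let: G := gradmx g X (draw zetas k w) in
      Phi (next_X A (al k) X T G) (next_T B T G))%:E <= (Psi X T)%:E)%E) ->
  (state_mean Phi k.+1 <= state_mean Psi k)%E.
Proof.
move=> B1 mPhi mPsi Phi0 h.
have [mX mT] := state_hist_measurable k; have [m1 m2] := transition_measurable mX mT.
pose F (t : histT zetas k * sampleT Z) : \bar R :=
  (Phi (transition t).1 (transition t).2)%:E.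
rewrite /state_mean (_ : (fun w => _) = (fun w => F (w, draw zetas k w))); last first.
  by apply/funext => w; rewrite state_S.
apply: (hist_fubini_le zetas_iid.1).
- by apply/measurable_EFinP; exact: mPhi.
- by move=> t; rewrite lee_fin.
- by apply/measurable_EFinP; exact: measurable_state_fun.
- by move=> w; exact: (h (state k w).1 (state k w).2 (state_sum0 k w B1)).
Qed.

End Process.

(** * Lyapunov function and rate *)

Section Drift.
Variables (R : realType) (n d : nat).
Hypothesis n_gt0 : (0 < n)%N.
Variables (dZ : 'I_n -> measure_display) (Z : forall i, measurableType (dZ i)).
Variables (dO : measure_display) (Omega : measurableType dO) (P : probability Omega R).
Variables (g : forall i, 'rV[R]_d -> Z i -> R) (zeta : forall i, {mfun Omega >-> Z i}).
Arguments g : clear implicits.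
Variable zetas : nat -> forall i, {mfun Omega >-> Z i}.
Hypothesis zetas_iid : iid_copies P (fun w i => zeta i w) (fun k w i => zetas k i w).
Hypothesis g_costs : finite_costs P g zeta.
Variable xstar : 'rV[R]_d.
Hypothesis xstar_opt : forall x, cost P g zeta xstar <= cost P g zeta x.
Variables (Lip : forall i, {mfun Z i >-> R}) (mu : R).
Hypothesis asm1 : objective_assumption P g zeta Lip mu xstar.
Variables (A B : 'M[R]_n) (u : 'rV[R]_n) (v : 'cV[R]_n).
Hypothesis net : network_assumption A B.
Hypothesis u_ge0 : forall i, 0 <= u 0 i.
Hypothesis u_eigen : u *m A = u.
Hypothesis u_sum : \sum_(i < n) u 0 i = n%:R.
Hypothesis v_ge0 : forall i, 0 <= v i 0.
Hypothesis v_eigen : B *m v = v.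
Hypothesis v_sum : \sum_(i < n) v i 0 = n%:R.
Variable x0 : 'I_n -> 'rV[R]_d.
Implicit Types X T G : 'M[R]_(n, d).

Definition potential (q : 'rV[R]_n) NA NB (c al : R) X T : R :=
  fro2 (corrected u q al X T - xstar) + qsum (Adefl A u) NA (disagreement u X)
  + c * al ^+ 2 * qsum (Bdefl B v) NB T.

Lemma potential_ge0 q NA NB c al X T : 0 <= c -> 0 <= potential q NA NB c al X T.
Proof.
move=> c0; apply: addr_ge0; first by rewrite addr_ge0 ?fro2_ge0 ?qsum_ge0.
by apply: mulr_ge0; [apply: mulr_ge0 => //; exact: sqr_ge0|exact: qsum_ge0].
Qed.

Lemma measurable_qsum dS (S : measurableType dS) (M : 'M[R]_n) N (f : S -> 'M[R]_(n, d)) :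
  mx_measurable f -> measurable_fun setT (fun s => qsum M N (f s)).
Proof.
move=> mf; apply: measurable_sum => t.
by apply: measurable_fro2; exact: mx_measurable_mulmx.
Qed.

Lemma borel2_potential q NA NB c al : borel2 (potential q NA NB c al).
Proof.
move=> dS S X T mX mT; apply: measurable_funD; first apply: measurable_funD.
- apply/measurable_fro2/mx_measurableB; last exact: mx_measurable_cst.
  apply: mx_measurableD; first exact: mx_measurable_mulmx.
  by apply: mx_measurableZ; exact: mx_measurable_mulmx.
- apply/measurable_qsum/mx_measurableB => //.
  by do 2 apply: mx_measurable_mulmx.
- by apply: measurable_funM; [exact: measurable_cst|exact: measurable_qsum].
Qed.

Lemma integral_le_mean (f h : Omega -> R) m : measurable_fun setT f ->
  (forall w, 0 <= f w) -> (forall w, f w <= h w) -> has_mean P h m ->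
  (\int[P]_w (f w)%:E <= m%:E)%E.
Proof.
move=> mf f0 fh [ih <-]; apply: ge0_le_integral => //.
- by move=> w _; rewrite lee_fin.
- exact/measurable_EFinP.
- by move/integrableP : ih => [].
- by move=> w _; rewrite lee_fin.
Qed.

Lemma gradmx_draw_measurable k X : mx_measurable (fun w => gradmx g X (draw zetas k w)).
Proof.
move=> i j; have [/integrableP[m _] _] := gradmx_mean zetas_iid g_costs asm1 k X i j.
exact/measurable_EFinP.
Qed.

Lemma gradmx_dotv_mean k X (a : 'rV[R]_d) :
  has_mean P (fun w => dotv a (const_mx 1 *m gradmx g X (draw zetas k w)))
    (dotv a (const_mx 1 *m meanmx P g zeta X)).
Proof.
have h j : has_mean P (fun w => \sum_i gradmx g X (draw zetas k w) i j)
    (\sum_i meanmx P g zeta X i j).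
  by apply: has_mean_sum => i; exact: (gradmx_mean zetas_iid g_costs asm1 k X i j).
have E (M : 'M[R]_(n, d)) : dotv a (const_mx 1 *m M) = \sum_j a 0 j * \sum_i M i j.
  apply: eq_bigr => j _; congr (_ * _); rewrite mxE.
  by apply: eq_bigr => i _; rewrite mxE mul1r.
rewrite E (_ : (fun w => _) = fun w => \sum_j a 0 j * \sum_i gradmx g X (draw zetas k w) i j).
  by apply: has_mean_sum => j; apply: has_meanZ; exact: h.
by apply/funext => w; rewrite E.
Qed.

(** All constants are chosen before the step-sizes, the time and the state, so one Lyapunov form and
    one threshold e serve the whole trajectory. The state is deterministic here; only the current
    draw is averaged. *)
Lemma drift_inequality (th K : R) : 0 < th -> th < weight u v / n%:R ^+ 2 * mu -> 0 <= K ->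
  exists q NA NB (c C e : R), [/\ 0 < e, e <= 1, th * e <= 1, 0 <= c & 0 <= C] /\
  (forall al X T, 0 <= al -> al <= 1 ->
     fro2 (ubar u *m X - xstar) <= C * potential q NA NB c al X T) /\
  forall k al al' X T, 0 < al -> al <= e -> 0 < al' -> al' <= al ->
    al - al' <= K * al ^+ 2 -> const_mx 1 *m T = 0 :> 'rV_d ->
    (\int[P]_w (let: G := gradmx g X (draw zetas k w) in
       potential q NA NB c al' (next_X A al X T G) (next_T B T G))%:E <=
     ((1 - th * al) * potential q NA NB c al X T + C * al ^+ 2)%:E)%E.
Proof.
move=> th0 thlt K0.
have w0 : 0 < weight u v / n%:R ^+ 2.
  by rewrite divr_gt0 ?exprn_gt0 ?ltr0n//; exact: (weight_gt0 n_gt0 net).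
set w := weight u v / n%:R ^+ 2 in w0 thlt.
have [q qE] := correction_exists n_gt0 u net v_eigen v_sum.
have [NA [rA [DA [rA0 rA1 DA0 geA hA]]]] := qsum_contract d (Adefl_small n_gt0 net u_sum).
have [NB [rB [DB [rB0 rB1 DB0 geB hB]]]] := qsum_contract d (Bdefl_small n_gt0 net v_sum).
(* Spends half of the margin between th and w mu on Young's inequality; the other half remains to
   absorb terms of higher order in al. *)
pose h := (mu - th / w) / 2.
have h0 : 0 < h by rewrite divr_gt0// subr_gt0 ltr_pdivrMr// mulrC.
have wh : w * (mu - h) - th = (w * mu - th) / 2.
  by rewrite /h; field; rewrite gt_eqF.
have p0 : 0 < w * (mu - h) - th by rewrite wh divr_gt0// subr_gt0.
have [Cd Cd0 hd] := descent_direction g_costs xstar_opt asm1 h0.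
have [CG CG0 hG] := gradmx_second_moment zetas_iid g_costs asm1.
have [C1 C10 h1] := error_drift n_gt0 u_eigen xstar qE K0.
have [C2 C20 h2] := disagreement_drift n_gt0 net u_eigen u_sum DA0 hA.
have [C3 C30 h3] := tracker_drift DB0 hB.
have [Sp Sp0 hSp] := spread_bound n_gt0 u d q.
have [Dd Dd0 hDd] := distance_bound n_gt0 u q xstar.
have [Av Av0 hAv] := average_bound n_gt0 u q xstar.
pose r := Num.max rA rB.
have r1 : r < 1 by rewrite gt_max rA1.
have r0 : 0 <= r by rewrite le_max rA0.
have r10 : 0 < 1 - r by rewrite subr_gt0.
pose k1 := C1 + C2; have k10 : 0 <= k1 by exact: addr_ge0.
(* The weight of the tracker form: its contraction outweighs, by exactly 1, the tracker terms k1
   al^2 created by the error and the disagreement. *)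
pose c2 := (k1 + 1) / (1 - r).
have c2E : c2 * (1 - r) - k1 = 1 by rewrite /c2 divfK ?gt_eqF//; ring.
have c21 : 1 <= c2 by rewrite ler_pdivlMr// mul1r; lra.
have c20 : 0 <= c2 by exact: le_trans c21.
pose k2 := C1 + C2 + c2 * C3; have k20 : 0 <= k2 by rewrite !addr_ge0// mulr_ge0.
pose H := w * (Cd * Sp); have H0 : 0 <= H.
  by apply: mulr_ge0; [exact: ltW|exact: mulr_ge0].
pose F := k2 * (CG * Dd); have F0 : 0 <= F by rewrite !mulr_ge0.
(* M dominates the three coefficients of al in [scalar_drift], and b below is at most each of the
   three right-hand sides; this is the origin of the threshold e = b / M. *)
pose M := 1 + F + H + th + c2 * th.
have cth : 0 <= c2 * th by rewrite mulr_ge0// ltW.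
have M1 : 1 <= M by rewrite /M; lra.
have M0 : 0 < M by exact: lt_le_trans M1.
pose b := Num.min (w * (mu - h) - th) (1 - r).
have b0 : 0 < b by rewrite lt_min p0.
have b1 : b <= 1 by rewrite ge_min; apply/orP; right; lra.
have e0 : 0 < b / M by rewrite divr_gt0.
have eM al : al <= b / M -> al * M <= b by rewrite ler_pdivlMr.
have le1 : b / M <= 1 by rewrite ler_pdivrMr// mul1r; exact: le_trans M1.
exists q, NA, NB, c2, (Av + k2 * CG), (b / M); split; [|split].
- split => //; last by rewrite addr_ge0// mulr_ge0.
  apply: (@le_trans _ _ (b / M * M)); last by rewrite divfK ?gt_eqF.
  rewrite mulrC; apply: ler_wpM2l; first exact: ltW.
  by rewrite /M; lra.
- move=> al X T al0 al1; apply: (le_trans (hAv al X T al1 al0)).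
  have W0 := potential_ge0 q NA NB al X T c20.
  apply: (@le_trans _ _ (Av * potential q NA NB c2 al X T)); last first.
    by rewrite mulrDl lerDl !mulr_ge0.
  apply: ler_wpM2l => //; rewrite /potential.
  have t0 := fro2_ge0 T.
  have t1 : al ^+ 2 * fro2 T <= c2 * al ^+ 2 * qsum (Bdefl B v) NB T.
    apply: ler_pM => //; first exact: sqr_ge0.
    by apply: ler_peMl => //; exact: sqr_ge0.
  move: t1 (qsum_ge0 (Adefl A u) NA (disagreement u X)); lra.
move=> k al al' X T al0 ale al'0 al'al alK T0.
have al1 : al <= 1 by exact: le_trans le1.
have s0 : 0 <= al ^+ 2 by exact: sqr_ge0.
have alM : al * M <= b by exact: eM.
set a := corrected u q al X T - xstar.
set qa := qsum (Adefl A u) NA (disagreement u X); set qb := qsum (Bdefl B v) NB T.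
(* The part of the pathwise bound that does not depend on the draw. The rest is linear in G or a
   multiple of [fro2 G], and is averaged with the mean field and the second moment. *)
pose base := (1 + al ^+ 2) * fro2 a + k1 * al ^+ 2 * fro2 T + r * qa + c2 * al ^+ 2 * (r * qb).
have [s hs sle] := hG k X.
have hmean := has_meanD (has_meanD (has_mean_cst P base)
  (has_meanZ (- (2 * (al * weight u v / n%:R ^+ 2))) (gradmx_dotv_mean k X a)))
  (has_meanZ (k2 * al ^+ 2) hs).
have qa0 : 0 <= qa by exact: qsum_ge0.
have qb0 : 0 <= qb by exact: qsum_ge0.
apply: le_trans.
  apply: (integral_le_mean _ _ _ hmean).
  - have mG := gradmx_draw_measurable k X.
    apply: (borel2_potential q NA NB c2 al').
      by apply: next_X_measurable => //; exact: mx_measurable_cst.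
    by apply: next_T_measurable => //; exact: mx_measurable_cst.
  - by move=> w'; exact: potential_ge0.
  - move=> w' /=; move: (gradmx g X (draw zetas k w')) => G.
    have e1 := h1 al al' X T G al0 al1 al'al alK T0.
    have e2 := h2 al X T G.
    have e3 := h3 T G T0.
    have g0 := fro2_ge0 G; have t0 := fro2_ge0 T.
    have e4 : rA * qa <= r * qa by apply: ler_wpM2r => //; rewrite le_max lexx.
    have e5 : rB * qb <= r * qb by apply: ler_wpM2r => //; rewrite le_max lexx orbT.
    (* As al' <= al, the new weight may be replaced by the old one. *)
    have e6 : c2 * al' ^+ 2 * qsum (Bdefl B v) NB (next_T B T G) <=
        c2 * al ^+ 2 * (r * qb + C3 * fro2 G).
      apply: ler_pM; [by rewrite mulr_ge0// sqr_ge0|exact: qsum_ge0| |].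
        by apply: ler_wpM2l => //; rewrite lerXn2r// nnegrE ltW.
      by apply: (le_trans e3); rewrite lerD2r.
    rewrite /potential /base /k1 /k2; rewrite -/a in e1; rewrite -/qa in e2.
    move: e1 e2 e6.
    lra.
rewrite lee_fin.
have dd := hd X (corrected u q al X T); rewrite -/a in dd.
have sp := hSp al X T.
have di := hDd al X T; rewrite -/a in di.
have aw : 0 <= al * w by rewrite mulr_ge0// ltW.
have g1 : - (2 * (al * weight u v / n%:R ^+ 2)) * dotv a (const_mx 1 *m meanmx P g zeta X) <=
   - (al * (w * (mu - h)) * fro2 a) + al * (H * (fro2 (disagreement u X) + al ^+ 2 * fro2 T)).
  move: dd; move: (dotv a _) => y dd.
  have := ler_wpM2l aw dd; have := ler_wpM2l (mulr_ge0 aw Cd0) sp.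
  by rewrite -[al * weight u v / _]mulrA -/w /H; lra.
have g2 : k2 * al ^+ 2 * s <= k2 * al ^+ 2 * (CG * (1 + Dd * (fro2 a +
    fro2 (disagreement u X) + al ^+ 2 * fro2 T))).
  apply: ler_wpM2l; first exact: mulr_ge0.
  by apply: (le_trans sle); apply: ler_wpM2l => //; rewrite lerD2l.
have bM c' : c' <= M -> al * c' <= b.
  by move=> c'M; apply: le_trans alM; apply: ler_wpM2l => //; exact: ltW.
have bp : b <= w * (mu - h) - th by rewrite ge_min lexx.
have br : b <= 1 - r by rewrite ge_min lexx orbT.
have m1 : 1 + F <= M by rewrite /M; lra.
have m2 : H + F + th <= M by rewrite /M; lra.
have m3 : H + F + c2 * th <= M by rewrite /M; lra.
have b3 : b <= c2 * (1 - r) - k1 by rewrite c2E.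
have sd := @scalar_drift R (w * (mu - h)) th r k1 k2 c2 CG Dd H al
  (fro2 a) (fro2 (disagreement u X)) (fro2 T) qa qb (ltW th0) k10 k20 CG0 Dd0 H0 c20 al0 al1
  (le_trans (bM _ m1) bp) (le_trans (bM _ m2) br) (le_trans (bM _ m3) b3)
  (fro2_ge0 _) (fro2_ge0 _) (fro2_ge0 _) (geA _) (geB _).
have av : 0 <= Av * al ^+ 2 by exact: mulr_ge0.
rewrite /potential -/a -/qa -/qb /base.
move: sd g1 g2 av; lra.
Qed.

End Drift.

(** * From the drift inequality to the rate *)

Section MeanSquareError.
Variables (R : realType) (n d : nat).
Hypothesis n_gt0 : (0 < n)%N.
Variables (dZ : 'I_n -> measure_display) (Z : forall i, measurableType (dZ i)).
Variables (dO : measure_display) (Omega : measurableType dO) (P : probability Omega R).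
Variables (g : forall i, 'rV[R]_d -> Z i -> R) (zeta : forall i, {mfun Omega >-> Z i}).
Arguments g : clear implicits.
Variable zetas : nat -> forall i, {mfun Omega >-> Z i}.
Hypothesis zetas_iid : iid_copies P (fun w i => zeta i w) (fun k w i => zetas k i w).
Hypothesis g_costs : finite_costs P g zeta.
Variable xstar : 'rV[R]_d.
Hypothesis xstar_opt : forall x, cost P g zeta xstar <= cost P g zeta x.
Variables (Lip : forall i, {mfun Z i >-> R}) (mu : R).
Hypothesis asm1 : objective_assumption P g zeta Lip mu xstar.
Variables (A B : 'M[R]_n) (u : 'rV[R]_n) (v : 'cV[R]_n).
Hypothesis net : network_assumption A B.
Hypothesis u_ge0 : forall i, 0 <= u 0 i.
Hypothesis u_eigen : u *m A = u.
Hypothesis u_sum : \sum_(i < n) u 0 i = n%:R.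
Hypothesis v_ge0 : forall i, 0 <= v i 0.
Hypothesis v_eigen : B *m v = v.
Hypothesis v_sum : \sum_(i < n) v i 0 = n%:R.
Variable x0 : 'I_n -> 'rV[R]_d.
Implicit Types X T G : 'M[R]_(n, d).

Definition mx_size X T : R := 1 + fro2 X + fro2 T.

Lemma mx_size_ge0 X T : 0 <= mx_size X T.
Proof. by rewrite /mx_size !addr_ge0 ?fro2_ge0. Qed.

Lemma borel2_mx_size : borel2 mx_size.
Proof.
move=> dS S X T mX mT; apply: measurable_funD; last exact: measurable_fro2.
by apply: measurable_funD; [exact: measurable_cst|exact: measurable_fro2].
Qed.

Lemma potential_le_size q NA NB c al : 0 <= c -> exists2 C, 0 <= C & forall X T,
  potential xstar A B u v q NA NB c al X T <= C * mx_size X T.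
Proof.
move=> c0.
have qsum_le (M : 'M[R]_n) N (Y : 'M[R]_(n, d)) : qsum M N Y <= (\sum_(t < N) fro2 (mpow M t)) * fro2 Y.
  by rewrite mulr_suml; apply: ler_sum => t _; exact: fro2_mulmx.
pose KA := \sum_(t < NA) fro2 (mpow (Adefl A u) t).
pose KB := \sum_(t < NB) fro2 (mpow (Bdefl B v) t).
have KA0 : 0 <= KA by apply: sumr_ge0 => t _; exact: fro2_ge0.
have KB0 : 0 <= KB by apply: sumr_ge0 => t _; exact: fro2_ge0.
pose ku := fro2 (ubar u); have ku0 : 0 <= ku by exact: fro2_ge0.
pose kc := fro2 (const_mx 1 *m ubar u : 'M[R]_n); have kc0 : 0 <= kc by exact: fro2_ge0.
pose kq := (al / n%:R) ^+ 2 * fro2 q.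
have kq0 : 0 <= kq by apply: mulr_ge0; [exact: sqr_ge0|exact: fro2_ge0].
pose kx := fro2 xstar; have kx0 : 0 <= kx by exact: fro2_ge0.
pose cB := c * al ^+ 2 * KB.
have cB0 : 0 <= cB by apply: mulr_ge0 => //; apply: mulr_ge0 => //; exact: sqr_ge0.
exists (4 * ku + 4 * kq + 2 * kx + KA * (2 + 2 * kc) + cB).
  by rewrite !addr_ge0// mulr_ge0// addr_ge0// mulr_ge0.
move=> X T; rewrite /potential /mx_size.
have x_ge0 := fro2_ge0 X; have t_ge0 := fro2_ge0 T.
have h1 : fro2 (corrected u q al X T - xstar) <=
    2 * (2 * (ku * fro2 X) + 2 * (kq * fro2 T)) + 2 * kx.
  apply: (le_trans (fro2D _ _)); rewrite fro2N lerD2r; apply: ler_wpM2l => //.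
  apply: (le_trans (fro2D _ _)); apply: lerD; apply: ler_wpM2l => //.
    exact: fro2_mulmx.
  rewrite fro2Z /kq; move: (fro2_mulmx q T) (sqr_ge0 (al / n%:R)).
  by move: (_ ^+ 2) => y qT y0; rewrite -mulrA; exact: ler_wpM2l.
have h2 : qsum (Adefl A u) NA (disagreement u X) <= KA * (2 * fro2 X + 2 * (kc * fro2 X)).
  apply: (le_trans (qsum_le _ _ _)); apply: ler_wpM2l => //.
  apply: (le_trans (fro2D _ _)); rewrite fro2N lerD2l; apply: ler_wpM2l => //.
  by rewrite mulmxA; exact: fro2_mulmx.
have h3 : c * al ^+ 2 * qsum (Bdefl B v) NB T <= cB * fro2 T.
  have : 0 <= c * al ^+ 2 by apply: mulr_ge0 => //; exact: sqr_ge0.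
  have := qsum_le (Bdefl B v) NB T; rewrite /cB -/KB.
  by move: (c * al ^+ 2) => y qT y0; rewrite -mulrA; exact: ler_wpM2l.
have := mulr_ge0 ku0 t_ge0; have := mulr_ge0 kq0 x_ge0.
have := mulr_ge0 kx0 x_ge0; have := mulr_ge0 kx0 t_ge0.
have := mulr_ge0 KA0 t_ge0; have := mulr_ge0 (mulr_ge0 KA0 kc0) t_ge0.
have := mulr_ge0 KA0 kc0; have := mulr_ge0 cB0 x_ge0.
move: h1 h2 h3; lra.
Qed.

Variable al : nat -> R.
Hypothesis al_gt0 : forall k, 0 < al k.

Local Notation smean := (state_mean P g zetas A B al x0).

Let state_fun_measurable Phi k : borel2 Phi -> measurable_fun setT
  (fun w => Phi (state g zetas A B al x0 k w).1 (state g zetas A B al x0 k w).2).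
Proof.
exact: (@measurable_state_fun _ _ _ _ _ _ _ _ _ _ zetas g_costs _ _ _ asm1 A B al x0 Phi k).
Qed.

Lemma state_mean_le (Phi Psi : 'M[R]_(n, d) -> 'M[R]_(n, d) -> R) (c : R) k :
  borel2 Phi -> borel2 Psi -> (forall X T, 0 <= Phi X T) -> (forall X T, 0 <= Psi X T) ->
  0 <= c -> (forall X T, Phi X T <= c * Psi X T) ->
  (smean Phi k <= c%:E * smean Psi k)%E.
Proof.
move=> mPhi mPsi Phi0 Psi0 c0 h; rewrite /state_mean -ge0_integralZl_EFin//.
- apply: ge0_le_integral => //.
  + by move=> w _; rewrite lee_fin.
  + apply/measurable_EFinP; exact: state_fun_measurable.
  + apply: measurable_funeM; apply/measurable_EFinP.
    exact: state_fun_measurable.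
  + by move=> w _; rewrite -EFinM lee_fin.
- by move=> w _; rewrite lee_fin.
- apply/measurable_EFinP; exact: state_fun_measurable.
Qed.

(** The scalar recursion needs a finite value at the time when the drift inequality starts to hold;
    induction with the crude growth bound provides it. *)
Lemma second_moment_finite k : (smean mx_size k < +oo)%E.
Proof.
elim: k => [|k IH].
  have [_ em] := has_mean_cst P (mx_size (\matrix_(i < n, j < d) x0 i 0 j) 0).
  have -> : smean mx_size 0%N = _ := em; exact: ltry.
have [CG CG0 hG] := gradmx_second_moment zetas_iid g_costs asm1.
pose c := 2 * fro2 A + 4 * al k ^+ 2 + 2 * (fro2 B + fro2 (B - 1%:M)).
have c0 : 0 <= c.
  have := fro2_ge0 A; have := fro2_ge0 B; have := fro2_ge0 (B - 1%:M).
  by have := sqr_ge0 (al k); rewrite /c; lra.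
pose f := fro2 (const_mx 1 *m xstar : 'M[R]_(n, d)); have f0 : 0 <= f by exact: fro2_ge0.
pose C := 1 + c + c * (CG * (3 + 2 * f)).
have C0 : 0 <= C.
  by apply: addr_ge0; [exact: addr_ge0|do 2 apply: mulr_ge0 => //; lra].
apply: (@le_lt_trans _ _ (smean (fun X T => C * mx_size X T) k)); last first.
  apply: (@le_lt_trans _ _ (C%:E * smean mx_size k)%E).
    apply: state_mean_le => //.
    - move=> dS S X T mX mT; apply: measurable_funM; first exact: measurable_cst.
      exact: borel2_mx_size.
    - exact: borel2_mx_size.
    - by move=> X T; rewrite mulr_ge0// mx_size_ge0.
    - exact: mx_size_ge0.
  exact: lte_mul_pinfty.
apply: (state_mean_step zetas_iid g_costs asm1).
- exact: net_B_col_stochastic net.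
- exact: borel2_mx_size.
- move=> dS S X T mX mT; apply: measurable_funM; first exact: measurable_cst.
  exact: borel2_mx_size.
- exact: mx_size_ge0.
move=> X T _; have [s hs sle] := hG k X.
have s_mean := has_meanD (has_mean_cst P (1 + c * (fro2 X + fro2 T))) (has_meanZ c hs).
apply: le_trans.
  apply: (integral_le_mean _ _ _ s_mean).
  - have mG := gradmx_draw_measurable zetas_iid g_costs asm1 k X.
    apply: borel2_mx_size.
      by apply: next_X_measurable => //; exact: mx_measurable_cst.
    by apply: next_T_measurable => //; exact: mx_measurable_cst.
  - by move=> w; exact: mx_size_ge0.
  - move=> w /=; move: (gradmx g X (draw zetas k w)) => G.
    have := fro2_next A B X T G (ltW (al_gt0 k)); rewrite -/c /mx_size.
    by lra.
rewrite lee_fin.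
have h1 : s <= CG * (1 + (2 * fro2 X + 2 * f)).
  apply: (le_trans sle); apply: ler_wpM2l => //; rewrite lerD2l.
  by apply: (le_trans (fro2D _ _)); rewrite fro2N.
have h2 := ler_wpM2l c0 h1.
have x_ge0 := fro2_ge0 X; have t_ge0 := fro2_ge0 T.
have cG := mulr_ge0 c0 CG0.
have := mulr_ge0 cG x_ge0; have := mulr_ge0 cG t_ge0.
have := mulr_ge0 (mulr_ge0 cG f0) x_ge0; have := mulr_ge0 (mulr_ge0 cG f0) t_ge0.
rewrite /mx_size /C; move: h2 x_ge0 t_ge0 c0 cG; lra.
Qed.

Lemma mse_state_mean k : mean_square_error P g zetas A B al x0 u xstar k =
  smean (fun X _ => fro2 (ubar u *m X - xstar)) k.
Proof.
rewrite /mean_square_error unlock; apply: eq_integral => w _; congr (_%:E).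
rewrite enorm_fro2; congr (fro2 (_ - _)).
rewrite (sab_state g zetas A B al x0 k w) /xbar /=.
rewrite /ubar -scalemxAl; congr (_ *: _).
apply/rowP => j; rewrite [LHS]summxE [RHS]mxE; apply: eq_bigr => i _.
by rewrite !mxE.
Qed.

(** Once the steps are small, the expected potential obeys the scalar recursion of [drift_rate];
    earlier times only enlarge the constant. *)
Lemma mse_rate (tau : R) : slowly_vanishing al tau ->
  tau < weight u v / n%:R ^+ 2 * mu ->
  exists2 c : R, 0 < c & forall k,
    (mean_square_error P g zetas A B al x0 u xstar k <= (c * al k)%:E)%E.
Proof.
move=> [_ al_le al_cvg al_slow] tau_lt.
have w0 : 0 < weight u v / n%:R ^+ 2 * mu.
  rewrite mulr_gt0 ?(obj_mu_gt0 asm1)// divr_gt0 ?exprn_gt0 ?ltr0n//.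
  exact: (weight_gt0 n_gt0 net).
(* The sign of tau is not prescribed, while the drift inequality asks for a nonnegative bound. *)
pose K := Num.max tau 0; have K0 : 0 <= K by rewrite le_max lexx orbT.
have Klt : K < weight u v / n%:R ^+ 2 * mu by rewrite gt_max tau_lt w0.
(* The midpoint keeps th strictly above the decay constant of the steps and strictly below the
   available contraction. *)
pose th := (K + weight u v / n%:R ^+ 2 * mu) / 2.
have th_bounds : [/\ 0 < th, K < th & th < weight u v / n%:R ^+ 2 * mu].
  by rewrite /th; split; lra.
have [th0 Kth thlt] := th_bounds.
have [q [NA [NB [c2 [C [e [[e0 e1 the c20 C0] [havg hdrift]]]]]]]] :=
  drift_inequality n_gt0 zetas_iid g_costs xstar_opt asm1 net u_ge0 u_eigen u_sum
    v_ge0 v_eigen v_sum th0 thlt K0.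
pose W k := potential xstar A B u v q NA NB c2 (al k).
have [K1 _ hK1] : \forall k \near \oo, al k <= e.
  move/cvgrPdist_le : al_cvg => /(_ _ e0); apply: filterS => k.
  by rewrite sub0r normrN ger0_norm// ltW.
have [K2 _ hK2] := al_slow.
pose K3 := maxn K1 K2.
have W0 k X T : 0 <= W k X T by exact: potential_ge0.
have mW k : borel2 (W k) by exact: borel2_potential.
have smean_ge0 Phi k : (forall X T, 0 <= Phi X T) -> (0 <= smean Phi k)%E.
  by move=> Phi0; apply: integral_ge0 => w _; rewrite lee_fin.
have size_fin k : smean mx_size k \is a fin_num.
  rewrite ge0_fin_numE; first exact: second_moment_finite.
  by apply: smean_ge0; exact: mx_size_ge0.
have W_fin k : smean (W k) k \is a fin_num.
  rewrite ge0_fin_numE; last exact: smean_ge0.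
  have [D D0 hD] := potential_le_size q NA NB (al k) c20.
  apply: (@le_lt_trans _ _ (D%:E * smean mx_size k)%E).
    by apply: state_mean_le => //; [exact: borel2_mx_size|exact: mx_size_ge0].
  by rewrite -(fineK (size_fin k)) -EFinM ltry.
pose w k := fine (smean (W k) k).
have wE k : smean (W k) k = (w k)%:E by rewrite /w fineK.
have B1 := net_B_col_stochastic net.
have step k : (K3 <= k)%N -> [/\ 0 < al k, th * al k <= 1,
     al k - al k.+1 <= K * al k ^+ 2
     & w k.+1 <= (1 - th * al k) * w k + C * al k ^+ 2].
  rewrite geq_max => /andP[k1 k2].
  have ale : al k <= e by exact: hK1.
  have th1 : th * al k <= 1.
    by apply: le_trans the; apply: ler_wpM2l => //; exact: ltW.
  have slow : al k - al k.+1 <= K * al k ^+ 2.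
    apply: (le_trans (hK2 k k2)); apply: ler_wpM2r; first exact: sqr_ge0.
    by rewrite le_max lexx.
  split => //.
  pose Psi X T := (1 - th * al k) * W k X T + C * al k ^+ 2.
  have mPsi : borel2 Psi.
    move=> dS S X T mX mT; apply: measurable_funD; last exact: measurable_cst.
    by apply: measurable_funM; [exact: measurable_cst|exact: mW].
  have Psi_mean : smean Psi k = ((1 - th * al k) * w k + C * al k ^+ 2)%:E.
    have hW : has_mean P (fun w => W k (state g zetas A B al x0 k w).1
        (state g zetas A B al x0 k w).2) (w k).
      split; last exact: wE.
      apply: integrable_ge0 => //.
        exact: state_fun_measurable.
      by rewrite -/(smean (W k) k) wE ltry.
    by have [_] := has_meanD (has_meanZ (1 - th * al k) hW) (has_mean_cst P (C * al k ^+ 2)).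
  rewrite -lee_fin -wE -Psi_mean.
  apply: (state_mean_step zetas_iid g_costs asm1) => // X T T0.
  exact: (hdrift k (al k) (al k.+1) X T).
have [D D0 hD] := drift_rate Kth C0 step.
have mse_avg k : (K3 <= k)%N ->
    (mean_square_error P g zetas A B al x0 u xstar k <= (C * D * al k)%:E)%E.
  move=> k3; rewrite mse_state_mean.
  apply: (@le_trans _ _ (C%:E * smean (W k) k)%E).
    apply: state_mean_le => //.
    - move=> dS S X T mX mT; apply: measurable_fro2; apply: mx_measurableB.
        exact: mx_measurable_mulmx.
      exact: mx_measurable_cst.
    - by move=> X T; exact: fro2_ge0.
    - move=> X T; apply: havg; first exact: ltW.
      apply: le_trans e1; apply: hK1; exact: leq_trans (leq_maxl _ _) k3.
  by rewrite wE -EFinM lee_fin -mulrA; apply: ler_wpM2l => //; exact: hD.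
have mse_fin k : exists2 m, 0 <= m &
    (mean_square_error P g zetas A B al x0 u xstar k <= m%:E)%E.
  pose f := 2 * fro2 (ubar u) + 2 * fro2 xstar.
  have u0 := fro2_ge0 (ubar u); have xs0 := fro2_ge0 xstar.
  have f0 : 0 <= f by rewrite addr_ge0// mulr_ge0.
  exists (f * fine (smean mx_size k)).
    by rewrite mulr_ge0// fine_ge0// smean_ge0//; exact: mx_size_ge0.
  rewrite mse_state_mean EFinM fineK//; apply: state_mean_le => //.
  - move=> dS S X T mX mT; apply: measurable_fro2; apply: mx_measurableB.
      exact: mx_measurable_mulmx.
    exact: mx_measurable_cst.
  - exact: borel2_mx_size.
  - by move=> X T; exact: fro2_ge0.
  - exact: mx_size_ge0.
  - move=> X T; apply: (le_trans (fro2D _ _)); rewrite fro2N.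
    have h1 := fro2_mulmx (ubar u) X.
    have x_ge0 := fro2_ge0 X; have t_ge0 := fro2_ge0 T.
    have := mulr_ge0 u0 t_ge0; have := mulr_ge0 xs0 t_ge0; have := mulr_ge0 xs0 x_ge0.
    rewrite /f /mx_size; move: h1 u0; lra.
pose m k := s2val (cid2 (mse_fin k)).
have m0 k : 0 <= m k by exact: s2valP (cid2 (mse_fin k)).
have mP k : (mean_square_error P g zetas A B al x0 u xstar k <= (m k)%:E)%E.
  exact: s2valP' (cid2 (mse_fin k)).
(* Adding all these ratios to the constant covers the finitely many times before K3. *)
have S0 : 0 <= \sum_(k < K3) m k / al k.
  by apply: sumr_ge0 => k _; rewrite divr_ge0// ltW.
exists (C * D + 1 + \sum_(k < K3) m k / al k).
  by rewrite ltr_wpDr// ltr_wpDl// mulr_ge0// ltW.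
have CD0 : 0 <= C * D by rewrite mulr_ge0// ltW.
move=> k; have [k3|k3] := leqP K3 k.
  apply: (le_trans (mse_avg k k3)); rewrite lee_fin; apply: ler_wpM2r; first exact: ltW.
  by rewrite -addrA lerDl addr_ge0.
apply: (le_trans (mP k)); rewrite lee_fin -ler_pdivrMr//.
rewrite (bigD1 (Ordinal k3))//= addrCA lerDl.
apply: addr_ge0; first exact: addr_ge0.
by apply: sumr_ge0 => i _; rewrite divr_ge0// ltW.
Qed.

End MeanSquareError.

(** * The two step-size schedules *)

Theorem theorem1 (R : realType) (n d : nat) (n_gt0 : (0 < n)%N) (d_gt0 : (0 < d)%N)
  (dZ : 'I_n -> measure_display) (Z : forall i, measurableType (dZ i))
  (dO : measure_display) (Omega : measurableType dO) (P : probability Omega R)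
  (g : forall i, 'rV[R]_d -> Z i -> R)
  (zeta : forall i, {mfun Omega >-> Z i})
  (zetas : nat -> forall i, {mfun Omega >-> Z i})
  (zetas_iid : iid_copies P (fun w i => zeta i w) (fun k w i => zetas k i w))
  (g_costs : finite_costs P g zeta)
  (xstar : 'rV[R]_d) (xstar_opt : forall x, cost P g zeta xstar <= cost P g zeta x)
  (Lip : forall i, {mfun Z i >-> R}) (mu : R)
  (asm1 : objective_assumption P g zeta Lip mu xstar)
  (A B : 'M[R]_n) (asm2 : network_assumption A B)
  (u : 'rV[R]_n) (u_ge0 : forall i, 0 <= u 0 i) (u_eigen : u *m A = u)
  (u_sum : \sum_(i < n) u 0 i = n%:R)
  (v : 'cV[R]_n) (v_ge0 : forall i, 0 <= v i 0) (v_eigen : B *m v = v)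
  (v_sum : \sum_(i < n) v i 0 = n%:R)
  (x0 : 'I_n -> 'rV[R]_d) :
  let L := mean_lipschitz P zeta Lip in
  let uv := (u *m v) 0 0 in
  let mse := fun alpha_ => mean_square_error P g zetas A B alpha_ x0 u xstar in
  (forall alpha a b : R, 1 / 2 < alpha < 1 -> 0 < a -> 0 < b ->
     a / b `^ alpha <= Num.min 1 (n%:R / (uv * L)) ->
     let alpha_ := fun k : nat => a / (k%:R + b) `^ alpha in
     exists2 c : R, 0 < c &
       forall k : nat, (mse alpha_ k <= (c * alpha_ k)%:E)%E)
  /\
  (forall a b : R, 0 < a -> 0 < b ->
     n%:R ^+ 2 / (uv * mu) < a ->
     a <= Num.min 1 (n%:R / (uv * L)) * b ->
     let alpha_ := fun k : nat => a / (k%:R + b) in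
     exists2 c : R, 0 < c &
       forall k : nat, (0 < k)%N -> (mse alpha_ k <= (c * (1 / k%:R))%:E)%E).
Proof.
move=> L uv mse.
have uv0 : 0 < uv by exact: (weight_gt0 n_gt0 asm2 u_ge0 u_eigen u_sum v_ge0 v_eigen v_sum).
have mu0 : 0 < mu := obj_mu_gt0 asm1.
have nR : 0 < n%:R :> R by rewrite ltr0n.
have rate := mse_rate n_gt0 zetas_iid g_costs xstar_opt asm1 asm2 u_ge0 u_eigen u_sum
  v_ge0 v_eigen v_sum x0.
have w0 : 0 < uv / n%:R ^+ 2 * mu by rewrite mulr_gt0// divr_gt0// exprn_gt0.
split.
- move=> alpha a b /andP[alpha_gt alpha1] a0 b0 _ alpha_.
  have alpha0 : 0 < alpha by lra.
  (* Any positive tau is available for an exponent below 1; half of the contraction rate lies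
     strictly below it. *)
  have slow : slowly_vanishing alpha_ (uv / n%:R ^+ 2 * mu / 2).
    by apply: step_power => //; [rewrite alpha0|rewrite divr_gt0].
  apply: (rate _ _ _ slow); first by case: slow.
  by rewrite ltr_pdivrMr// -[X in X < _]mulr1 ltr_pM2l// ltrDl.
- move=> a b a0 b0 a_gt _ alpha_.
  have slow : slowly_vanishing alpha_ a^-1 by exact: step_harmonic.
  have al0 : forall k, 0 < alpha_ k by case: slow.
  have [c c0 hc] : exists2 c : R, 0 < c & forall k, (mse alpha_ k <= (c * alpha_ k)%:E)%E.
    apply: (rate _ al0 _ slow).
    (* In this form the requirement tau = 1/a < mu uv/n^2 is the inverse of the lower bound assumed
       on a. *)
    have -> : uv / n%:R ^+ 2 * mu = (n%:R ^+ 2 / (uv * mu))^-1.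
      by rewrite invf_div mulrAC.
    by rewrite ltf_pV2 ?posrE// divr_gt0 ?exprn_gt0 ?mulr_gt0.
  exists (c * a) => [|k k0]; first exact: mulr_gt0.
  apply: (le_trans (hc k)); rewrite lee_fin -mulrA; apply: ler_wpM2l; first exact: ltW.
  rewrite div1r; apply: ler_wpM2l; first exact: ltW.
  by rewrite lef_pV2 ?posrE ?ltr0n ?ltr_wpDl ?lerDl// ltW.
Qed.
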